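(* Let $k\ge 1$. Suppose the density of the set of trajectories at time $k-1$ (given measurements up to time $k-1$) is a trajectory MBM with $n_{k-1|k-1}$ tracks, track $i$ having $h^i_{k-1|k-1}$ single trajectory hypotheses with parameters $(w^{i,a^i}_{k-1|k-1}, r^{i,a^i}_{k-1|k-1}, f^{i,a^i}_{k-1|k-1})$ and measurement histories $\mathcal{M}^{k-1}(i,a^i)$. Suppose each trajectory evolves according to the transition model for the set of current trajectories, and new trajectories are born according to an independent trajectory multi-Bernoulli RFS with $n^b_k$ components, component $l$ having existence probability $r^{b,l}_k$ and density $f^{B,l}_k$. Then the predicted density at time $k$ is a trajectory MBM with $n_{k|k-1}=n_{k-1|k-1}+n^b_k$ tracks and the following parameters. For tracks $i\in\{1,\dots,n_{k-1|k-1}\}$: $h^i_{k|k-1}=h^i_{k-1|k-1}$, measurement histories unchanged, and for all $a^i$, $$w^{i,a^i}_{k|k-1}=w^{i,a^i}_{k-1|k-1},\quad r^{i,a^i}_{k|k-1}=r^{i,a^i}_{k-1|k-1}\langle f^{i,a^i}_{k-1|k-1};P^S_{k-1}\rangle,\quad f^{i,a^i}_{k|k-1}(X)=\frac{\int \pi^c(X|X')P^S_{k-1}(X')f^{i,a^i}_{k-1|k-1}(X')dX'}{\langle f^{i,a^i}_{k-1|k-1};P^S_{k-1}\rangle}.$$ For new tracks $i=n_{k-1|k-1}+l$, $l\in\{1,\dots,n^b_k\}$: $h^i_{k|k-1}=1$, $\mathcal{M}^{k-1}(i,1)=\emptyset$, $w^{i,1}_{k|k-1}=1$, $r^{i,1}_{k|k-1}=r^{b,l}_k$,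 $f^{i,1}_{k|k-1}=f^{B,l}_k$. The set of global hypotheses is the set of old global hypotheses each extended by $a^i=1$ for every new track.
   Context: Single target state space $\mathcal{X}=\mathbb{R}^n$. A trajectory is $X=(\beta,\varepsilon,x_{\beta:\varepsilon})$ with integers $0\le\beta\le\varepsilon\le k$ (start and end time) and $x_{\beta:\varepsilon}=(x_\beta,\dots,x_\varepsilon)\in\mathcal{X}^{\varepsilon-\beta+1}$; the trajectory space at time $k$ is $\mathcal{T}_k=\biguplus_{0\le\beta\le\varepsilon\le k}\{\beta\}\times\{\varepsilon\}\times\mathcal{X}^{\varepsilon-\beta+1}$, with $\int p(X)dX=\sum_{(\beta,\varepsilon)}\int p(\beta,\varepsilon,x_{\beta:\varepsilon})dx_{\beta:\varepsilon}$. Set integral: $\int g(\mathbf{X})\delta\mathbf{X}=g(\emptyset)+\sum_{n\ge1}\frac1{n!}\int g(\{X^1,\dots,X^n\})dX^1\cdots dX^n$. Notation $\langle h;g\rangle=\int h(X)g(X)dX$. $\Delta_a(b)$ is the Kronecker delta, $\delta$ the Dirac delta. A Bernoulli density with parameters $(r,f)$ is $1-r$ at $\emptyset$, $rf(X)$ at $\{X\}$, $0$ otherwise. A trajectory MBM with track table $\mathbb{T}=\{1,\dots,n\}$, track $i$ having hypotheses $a^i\in\{1,\dots,h^i\}$ each with weight $w^{i,a^i}$, Bernoulli parameters $(r^{i,a^i},f^{i,a^i})$ and measurement history $\mathcal{M}(i,a^i)$ (a set of pairs $(\tau,j)$, measurement $j$ at time $\tau$, at most one per time), is the density $f(\mathbf{X})=\sum_{a\in\mathcal{A}}w^a\sum_{\uplus_{i\in\mathbb{T}}\mathbf{X}^i=\mathbf{X}}\prod_{i\in\mathbb{T}}f^{i,a^i}(\mathbf{X}^i)$,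 where $f^{i,a^i}(\cdot)$ is the Bernoulli density with parameters $(r^{i,a^i},f^{i,a^i})$, $\mathcal{A}$ is the set of global hypotheses $a=(a^1,\dots,a^n)$ whose histories $\mathcal{M}(i,a^i)$ are pairwise disjoint subsets of the set of all measurement indices received so far, and $w^a\propto\prod_i w^{i,a^i}$ normalized over $\mathcal{A}$. Transition model for the set of current trajectories: a single trajectory $X'$ at time $k-1$ survives with probability $P^S_{k-1}(X')=P^S(x'_{\varepsilon'})\Delta_{k-1}(\varepsilon')$ (otherwise it disappears from the set) and, if it survives, becomes $X$ with density $\pi^c(X|X')=\pi^x(x_\varepsilon|x'_{\varepsilon'})\delta_{x'_{\beta':\varepsilon'}}(x_{\beta:\varepsilon-1})\Delta_{\varepsilon'+1}(\varepsilon)\Delta_{\beta'}(\beta)$, where $\pi^x$ is the single-target Markov transition density; trajectories evolve independently. Birth component densities: $f^{B,l}_k(X)=f^{b,l}_k(x_k)\Delta_k(\beta)\Delta_k(\varepsilon)$ with $f^{b,l}_k$ a density on $\mathcal{X}$. *)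

(* Defs.v *)
From HB Require Import structures.
From mathcomp Require Import all_boot all_order all_algebra.
From mathcomp Require Import all_classical all_reals all_analysis measurable_realfun.
Set Implicit Arguments. Unset Strict Implicit. Unset Printing Implicit Defensive.
Import Order.TTheory GRing.Theory Num.Theory.
Local Open Scope classical_set_scope.
Local Open Scope ring_scope.

Section TrajectoryMBM.
Context {R : realType} (n : nat).

Definition state0 : n.-tuple R := [tuple 0 | _ < n].

(* a trajectory X = (beta, eps, x_{beta:eps}); the list of states has
   eps - beta + 1 elements for all trajectories reached by the integrals below *)
Definition traj := (nat * nat * seq (n.-tuple R))%type.
Definition tb (X : traj) : nat := X.1.1.
Definition te (X : traj) : nat := X.1.2.
Definition tx (X : traj) : seq (n.-tuple R) := X.2.
Definition lastst (X : traj) : n.-tuple R := last state0 (tx X).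
Definition ext (X : traj) (y : n.-tuple R) : traj := (tb X, (te X).+1, rcons (tx X) y).

Definition tlen (b e : nat) : nat := ((e - b).+1 * n)%N.
Definition blk (t : seq R) (j : nat) : n.-tuple R := [tuple nth 0 t (j * n + i)%N | i < n].
Definition states (m : nat) (t : seq R) : seq (n.-tuple R) := [seq blk t j | j <- iota 0 m].
Definition mktraj (b e : nat) (t : seq R) : traj := (b, e, states (e - b).+1 t).
Fixpoint decode (sh : seq (nat * nat)) (t : seq R) : seq traj :=
  match sh with
  | [::] => [::]
  | (b, e) :: sh' => mktraj b e (take (tlen b e) t) :: decode sh' (drop (tlen b e) t)
  end.
Definition shlen (sh : seq (nat * nat)) : nat := sumn [seq tlen p.1 p.2 | p <- sh].

Local Open Scope ereal_scope.

(* Lebesgue integral over R^N of a nonnegative function, written as an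
   iterated integral (Tonelli) *)
Fixpoint iint (N : nat) : (N.-tuple R -> \bar R) -> \bar R :=
  match N with
  | 0 => fun G => G [tuple]
  | N'.+1 => fun G => \int[@lebesgue_measure R]_x @iint N' (fun t => G [tuple of x :: t])
  end.
Local Arguments iint N G : clear implicits.

Definition trajint (K : nat) (p : traj -> \bar R) : \bar R :=
  \sum_(e < K.+1) \sum_(b < e.+1) iint (tlen b e) (fun t => p (mktraj b e t)).

Definition shape_of (K : nat) (sh : seq ('I_K.+1 * 'I_K.+1)) : seq (nat * nat) :=
  [seq (nat_of_ord p.1, nat_of_ord p.2) | p <- sh].

(* set integral over finite subsets of T_K (finite sets represented by lists):
   g(emptyset) + sum_{m>=1} 1/m! int g({X^1..X^m}) dX^1...dX^m *)
Definition setint (K : nat) (g : seq traj -> \bar R) : \bar R :=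
  \sum_(m <oo) (((m`!)%:R : R)^-1)%:E *
    \sum_(sh : m.-tuple ('I_K.+1 * 'I_K.+1) | all (fun p : 'I_K.+1 * 'I_K.+1 => (p.1 <= p.2)%N) sh)
       iint (shlen (shape_of sh)) (fun t => g (decode (shape_of sh) t)).

Definition traj_meas (p : traj -> \bar R) : Prop :=
  forall b e : nat, measurable_fun setT (fun t : (tlen b e).-tuple R => p (mktraj b e t)).
Definition set_meas (g : seq traj -> \bar R) : Prop :=
  forall sh : seq (nat * nat),
    measurable_fun setT (fun t : (shlen sh).-tuple R => g (decode sh t)).
(* functions of finite sets: invariant under reordering of the list *)
Definition set_sym (g : seq traj -> \bar R) : Prop :=
  forall s1 s2 : seq traj, perm_eq s1 s2 -> g s1 = g s2.

Local Close Scope ereal_scope.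

Definition bern (r : R) (f : traj -> R) (s : seq traj) : R :=
  match s with
  | [::] => 1 - r
  | [:: X] => r * f X
  | _ => 0
  end.

(* multi-Bernoulli density: sum over all ways X = U_i X^i (labelled
   decompositions, element j going to component sig j) of prod_i f^i(X^i) *)
Definition mb_dens (N : nat) (r : 'I_N -> R) (f : 'I_N -> traj -> R) (X : seq traj) : R :=
  \sum_(sig : {ffun 'I_(size X) -> 'I_N})
    \prod_(i < N) bern (r i) (f i)
        [seq nth (0%N, 0%N, [::]) X (nat_of_ord j) | j <- enum 'I_(size X) & sig j == i].

(* parameters of a trajectory MBM; tracks i < nt, hypotheses a < nh i
   (0-based indices: track i / hypothesis a here is i+1 / a+1 in the paper) *)
Record mbm := MBM {
  nt : nat;
  nh : nat -> nat;
  wt : nat -> nat -> R;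
  ex : nat -> nat -> R;
  den : nat -> nat -> traj -> R;
  hist : nat -> nat -> seq (nat * nat)  (* M(i,a): pairs (time, measurement index) *)
}.

(* global hypotheses: a^i < h^i, histories pairwise disjoint and contained in
   the set Meas of all measurement indices received so far *)
Definition gh_valid (M : mbm) (Meas : seq (nat * nat)) (a : 'I_(nt M) -> nat) : bool :=
  [forall i : 'I_(nt M), (a i < nh M i)%N] &&
  [forall i : 'I_(nt M), [forall j : 'I_(nt M), (i != j) ==>
      all (fun p => p \notin hist M j (a j)) (hist M i (a i))]] &&
  [forall i : 'I_(nt M), all (fun p => p \in Meas) (hist M i (a i))].


Local Arguments gh_valid M Meas a : clear implicits.

Definition hmax (M : mbm) : nat := (\max_(i < nt M) nh M i)%N.
Definition gh_weight (M : mbm) (a : 'I_(nt M) -> nat) : R := \prod_(i < nt M) wt M i (a i).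


Local Arguments gh_weight M a : clear implicits.

Definition mbm_dens (M : mbm) (Meas : seq (nat * nat)) (X : seq traj) : R :=
  let Z := \sum_(a : {ffun 'I_(nt M) -> 'I_(hmax M)} | gh_valid M Meas (fun i => a i))
             gh_weight M (fun i => a i) in
  \sum_(a : {ffun 'I_(nt M) -> 'I_(hmax M)} | gh_valid M Meas (fun i => a i))
     (gh_weight M (fun i => a i) / Z) *
     mb_dens (fun i : 'I_(nt M) => ex M i (a i)) (fun i => den M i (a i)) X.

Definition mbm_wf (M : mbm) (K : nat) : Prop :=
  forall i a, (i < nt M)%N -> (a < nh M i)%N ->
    [/\ (0 < nh M i)%N /\ 0 <= wt M i a, 0 <= ex M i a <= 1,
        (forall X, 0 <= den M i a X) /\ traj_meas (fun X => (den M i a X)%:E),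
        trajint K (fun X => (den M i a X)%:E) = 1%E
      & uniq [seq p.1 | p <- hist M i a]].

Definition PSk (PS : n.-tuple R -> R) (k : nat) (X : traj) : R :=
  if te X == k.-1 then PS (lastst X) else 0.

Definition fB (k : nat) (fb : n.-tuple R -> R) (X : traj) : R :=
  if (tb X == k) && (te X == k) then fb (lastst X) else 0.

Local Open Scope ereal_scope.

(* int h(X) pi^c(X|X') dX, pi^c(X|X') = pi^x(x_eps|x'_eps') delta_{x'}(x_{beta:eps-1})
   Delta_{eps'+1}(eps) Delta_{beta'}(beta): the Dirac delta integrates out *)
Definition pic_int (pix : n.-tuple R -> n.-tuple R -> R) (h : traj -> \bar R) (X' : traj)
  : \bar R := iint n (fun y => (pix y (lastst X'))%:E * h (ext X' y)).

Definition birth_int (k nb : nat) (rb : nat -> R) (fb : nat -> n.-tuple R -> R)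
  (g : seq traj -> \bar R) : \bar R :=
  setint k (fun Y => g Y *
    (mb_dens (fun l : 'I_nb => rb l) (fun l : 'I_nb => fB k (fb l)) Y)%:E).

(* expectation of g(X_k) given X_{k-1} = L: each trajectory independently
   survives w.p. P^S_{k-1} and is then extended by pi^c, plus independent births *)
Fixpoint trans_int (k : nat) (PS : n.-tuple R -> R) (pix : n.-tuple R -> n.-tuple R -> R)
  (B : (seq traj -> \bar R) -> \bar R) (L : seq traj) (g : seq traj -> \bar R) : \bar R :=
  match L with
  | [::] => B g
  | X :: L' =>
      ((1 - PSk PS k X)%R)%:E * trans_int k PS pix B L' g +
      (PSk PS k X)%:E *
        iint n (fun y => (pix y (lastst X))%:E *
                         trans_int k PS pix B L' (fun S => g (ext X y :: S)))
  end.

(* int g(X) f_{k|k-1}(X) deltaX, where f_{k|k-1}(X) = int f(X|X') f_{k-1|k-1}(X') deltaX' *)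
Definition pred_expect (k : nat) (PS : n.-tuple R -> R) (pix : n.-tuple R -> n.-tuple R -> R)
  (nb : nat) (rb : nat -> R) (fb : nat -> n.-tuple R -> R)
  (fold : seq traj -> R) (g : seq traj -> \bar R) : \bar R :=
  setint k.-1 (fun X' => (fold X')%:E * trans_int k PS pix (birth_int k nb rb fb) X' g).

Definition ipS (k : nat) (PS : n.-tuple R -> R) (f : traj -> R) : \bar R :=
  trajint k.-1 (fun X => (f X * PSk PS k X)%:E).

(* fp(X) = int pi^c(X|X') P^S_{k-1}(X') f(X') dX' / <f ; P^S_{k-1}>,
   understood as densities: tested against all nonnegative measurable h *)
Definition is_pred_density (k : nat) (PS : n.-tuple R -> R)
  (pix : n.-tuple R -> n.-tuple R -> R) (f fp : traj -> R) : Prop :=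
  forall h : traj -> \bar R, traj_meas h -> (forall X, 0 <= h X) ->
    trajint k (fun X => h X * (fp X)%:E) =
    (ipS k PS f)^-1 * trajint k.-1 (fun X' => (PSk PS k X' * f X')%:E * pic_int pix h X').

Local Close Scope ereal_scope.

Definition pred_mbm (k : nat) (PS : n.-tuple R -> R) (M : mbm) (nb : nat)
  (rb : nat -> R) (fb : nat -> n.-tuple R -> R) (fp : nat -> nat -> traj -> R) : mbm :=
  MBM (nt M + nb)
    (fun i => if (i < nt M)%N then nh M i else 1%N)
    (fun i a => if (i < nt M)%N then wt M i a else 1)
    (fun i a => if (i < nt M)%N then ex M i a * fine (ipS k PS (den M i a))
                else rb (i - nt M)%N)
    (fun i a => if (i < nt M)%N then fp i a else fB k (fb (i - nt M)%N))
    (fun i a => if (i < nt M)%N then hist M i a else [::]).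

End TrajectoryMBM.

Arguments iint {R} N G.
Arguments gh_valid {R n} M Meas a.
Arguments gh_weight {R n} M a.

(* Main.v *)
(* A multi-Bernoulli density is a labelled convolution of Bernoulli densities, so
   its set integral against a symmetric g factors into an iterated expectation
   [mbexp] that draws one Bernoulli component at a time: the 1/m! of the set
   integral cancels the m choices of the element produced by a given component.
   The expectation of g after the transition is itself symmetric in the old
   trajectories (by Tonelli), so the same holds for the prediction.  Pushing the
   transition through [mbexp] one component at a time, a component (r, f) is absent
   afterwards with probability (1 - r) + r (1 - <f; P^S>) = 1 - r <f; P^S>, and is
   otherwise a trajectory with the predicted density; the birth components are
   drawn last.  The mixture over global hypotheses is carried along linearly. *)
Require Import Defs.
From HB Require Import structures.
From mathcomp Require Import all_boot all_order all_algebra.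
From mathcomp Require Import all_classical all_reals all_analysis measurable_realfun.
Import Order.TTheory GRing.Theory Num.Theory.
Local Open Scope classical_set_scope.
Local Open Scope ring_scope.
Set Implicit Arguments. Unset Strict Implicit. Unset Printing Implicit Defensive.

(** The kernel [pi^c] contains a Dirac factor, which has a meaning only under an integral. Hence
    [is_pred_density] and the conclusion are equalities of integrals against nonnegative test
    functions, and the proof transports such integrals instead of formulas for densities. Values in
    [\bar R] and nonnegativity give Tonelli without integrability conditions, but every exchange
    needs joint measurability. The obstacle is that a list of trajectories has coordinates in a
    different Euclidean space for each shape. Measurability is therefore required shape by shape,
    always with an extra parameter, and each functional used is shown to preserve measurability in
    that parameter. A second mismatch: [mb_dens] labels the elements of the set, whereas the
    expectation recurses over components. Passing from one to the other requires a class of products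
    closed under giving an element to a component, larger than the Bernoulli densities. Finally, a
    component with [<f; P^S> = 0] has no normalised predicted density; its surviving part must be
    shown to contribute nothing. *)

Section MeasurableComposition.
Context {d d1 d2 d3 : measure_display} {T : measurableType d} {A : measurableType d1}
  {B : measurableType d2} {C : measurableType d3}.

Lemma measurable_precomp (F : A -> C) (u : T -> A) :
  measurable_fun setT F -> measurable_fun setT u -> measurable_fun setT (fun x => F (u x)).
Proof. exact: measurableT_comp. Qed.

Lemma measurable_comp2 (F : A * B -> C) (u : T -> A) (v : T -> B) :
  measurable_fun setT F -> measurable_fun setT u -> measurable_fun setT v ->
  measurable_fun setT (fun x => F (u x, v x)).
Proof. by move=> mF mu mv; exact: (measurableT_comp mF (measurable_fun_pair mu mv)). Qed.

End MeasurableComposition.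

(** * Iterated Lebesgue integrals: linearity, monotone series, Tonelli *)

Section IteratedIntegral.
Context {R : realType}.
Local Open Scope ereal_scope.

Lemma iint_ge0 N (G : N.-tuple R -> \bar R) : (forall t, 0 <= G t) -> 0 <= iint N G.
Proof.
elim: N G => [|N IH] G G0 //=.
by apply: integral_ge0 => x _; exact: IH.
Qed.

Lemma eq_iint N (F G : N.-tuple R -> \bar R) : F =1 G -> iint N F = iint N G.
Proof. by move=> /funext ->. Qed.

(** The parameter space is arbitrary because the induction enlarges it: the outermost variable is
    moved from the tuple into [T * R], and Tonelli's measurability statement then integrates it
    out. *)
Lemma measurable_iint N d (T : measurableType d) (G : T -> N.-tuple R -> \bar R) :
  measurable_fun setT (fun p : T * N.-tuple R => G p.1 p.2) ->
  (forall x t, 0 <= G x t) -> measurable_fun setT (fun x => iint N (G x)).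
Proof.
elim: N d T G => [|N IH] d T G mG G0 /=.
  exact: (measurable_comp2 (u := id) (v := fun=> [tuple]) mG).
apply: (@measurable_fun_fubini_tonelli_F _ _ _ _ _ (@lebesgue_measure R)
  (fun p : T * R => iint N (fun t => G p.1 [tuple of p.2 :: t]))).
  apply: (IH _ _ (fun (p : T * R) t => G p.1 [tuple of p.2 :: t])) => //.
  apply: (measurable_comp2 mG); first exact: measurableT_comp.
  by apply: measurable_cons => //; exact: measurableT_comp.
by move=> p; exact: iint_ge0.
Qed.

Lemma measurable_tuple_cons N (x : R) (G : N.+1.-tuple R -> \bar R) :
  measurable_fun setT G -> measurable_fun setT (fun t : N.-tuple R => G [tuple of x :: t]).
Proof. by move=> mG; apply: (measurable_precomp mG); exact: measurable_cons. Qed.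

Lemma measurable_iint_cons N (G : N.+1.-tuple R -> \bar R) :
  measurable_fun setT G -> (forall t, 0 <= G t) ->
  measurable_fun setT (fun x : R => iint N (fun t => G [tuple of x :: t])).
Proof.
move=> mG G0; apply: (@measurable_iint N _ _ (fun x t => G [tuple of x :: t])) => //.
by apply: (measurable_precomp mG); exact: measurable_cons.
Qed.

Lemma iint0 N : iint N (fun=> 0) = 0 :> \bar R.
Proof. by elim: N => [|N IH] //=; under eq_integral do rewrite IH; exact: integral0. Qed.

Lemma iintD N (F G : N.-tuple R -> \bar R) :
  measurable_fun setT F -> (forall t, 0 <= F t) ->
  measurable_fun setT G -> (forall t, 0 <= G t) ->
  iint N (fun t => F t + G t) = iint N F + iint N G.
Proof.
elim: N F G => [|N IH] F G mF F0 mG G0 //=.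
under eq_integral do (rewrite IH //; try exact: measurable_tuple_cons).
by apply: ge0_integralD => //; [move=> *; exact: iint_ge0| exact: measurable_iint_cons
  | move=> *; exact: iint_ge0| exact: measurable_iint_cons].
Qed.

Lemma iintZ N (c : \bar R) (F : N.-tuple R -> \bar R) : 0 <= c ->
  measurable_fun setT F -> (forall t, 0 <= F t) ->
  iint N (fun t => c * F t) = c * iint N F.
Proof.
move=> c0; elim: N F => [|N IH] F mF F0 //=.
under eq_integral do (rewrite IH //; try exact: measurable_tuple_cons).
by apply: ge0_integralZl => //; [exact: measurable_iint_cons | move=> *; exact: iint_ge0].
Qed.

Lemma iint_sum N (I : Type) (s : seq I) (P : pred I) (F : I -> N.-tuple R -> \bar R) :
  (forall i, P i -> measurable_fun setT (F i)) -> (forall i t, P i -> 0 <= F i t) ->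
  iint N (fun t => \sum_(i <- s | P i) F i t) = \sum_(i <- s | P i) iint N (F i).
Proof.
move=> mF F0; elim: s => [|i s IH].
  by rewrite big_nil -[RHS](iint0 N); apply: eq_iint => t; rewrite big_nil.
rewrite big_cons -IH; under eq_iint do rewrite big_cons.
case: (boolP (P i)) => // Pi; apply: iintD => //; first exact: mF.
- by move=> t; exact: F0.
- under eq_fun do rewrite big_mkcond.
  by apply: emeasurable_sum => j; case: (boolP (P j)) => [/mF //|_]; exact: measurable_cst.
- by move=> t; apply: sume_ge0 => j; exact: F0.
Qed.

Lemma iint_nneseries N (F : nat -> N.-tuple R -> \bar R) :
  (forall i, measurable_fun setT (F i)) -> (forall i t, 0 <= F i t) ->
  iint N (fun t => \sum_(i <oo) F i t) = \sum_(i <oo) iint N (F i).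
Proof.
elim: N F => [|N IH] F mF F0 //=.
under eq_integral do (rewrite IH //; try (move=> *; exact: measurable_tuple_cons)).
apply: integral_nneseries => //.
  by move=> i; exact: measurable_iint_cons.
by move=> *; exact: iint_ge0.
Qed.

Lemma integral_iint N (G : R -> N.-tuple R -> \bar R) :
  measurable_fun setT (fun p : R * N.-tuple R => G p.1 p.2) ->
  (forall x t, 0 <= G x t) ->
  \int[@lebesgue_measure R]_x iint N (G x) =
  iint N (fun t => \int[@lebesgue_measure R]_x G x t).
Proof.
elim: N G => [|N IH] G mG G0 //=.
rewrite (@fubini_tonelli _ _ _ _ _ (@lebesgue_measure R) (@lebesgue_measure R)
  (fun p : R * R => iint N (fun t => G p.1 [tuple of p.2 :: t]))) /=.
- apply: eq_integral => y _; apply: IH => //.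
  by apply: (measurable_comp2 mG) => //; exact: measurable_cons.
- apply: (@measurable_iint N _ _ (fun (p : R * R) t => G p.1 [tuple of p.2 :: t])) => //.
  apply: (measurable_comp2 mG); first exact: measurableT_comp.
  by apply: measurable_cons => //; exact: measurableT_comp.
- by move=> p; exact: iint_ge0.
Qed.

Lemma iint_swap N N' (G : N.-tuple R -> N'.-tuple R -> \bar R) :
  measurable_fun setT (fun p : N.-tuple R * N'.-tuple R => G p.1 p.2) ->
  (forall s t, 0 <= G s t) ->
  iint N (fun s => iint N' (G s)) = iint N' (fun t => iint N (G ^~ t)).
Proof.
elim: N G => [|N IH] G mG G0 //=.
under eq_integral => x _.
  rewrite (IH (fun s => G [tuple of x :: s])) //; last first.
    by apply: (measurable_comp2 mG) => //; exact: measurable_cons.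
  over.
apply: (@integral_iint N' (fun x t => iint N (fun s => G [tuple of x :: s] t))).
  apply: (@measurable_iint N _ _ (fun p s => G [tuple of p.1 :: s] p.2)) => //.
  apply: (measurable_comp2 mG); last exact: measurableT_comp.
  by apply: measurable_cons => //; exact: measurableT_comp.
by move=> *; exact: iint_ge0.
Qed.

(** No measurability enters: both sides are the same iterated integral, with the variables in the
    same order. *)
Lemma iint_cat N N' (G : (N + N').-tuple R -> \bar R) :
  iint (N + N') G = iint N (fun s => iint N' (fun t => G [tuple of s ++ t])).
Proof.
elim: N G => [|N IH] G /=.
  by apply: eq_iint => t; congr G; exact: val_inj.
apply: eq_integral => x _; rewrite IH.
by apply: eq_iint => s; apply: eq_iint => t; congr G; exact: val_inj.
Qed.

Lemma measurable_cat d (T : measurableType d) N N' (u : T -> N.-tuple R)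
    (v : T -> N'.-tuple R) :
  measurable_fun setT u -> measurable_fun setT v ->
  measurable_fun setT (fun x => [tuple of u x ++ v x]).
Proof.
move=> /measurable_fun_tnthP mu /measurable_fun_tnthP mv.
apply/measurable_fun_tnthP => i; case: (split_ordP i) => j ->.
  rewrite (_ : _ \o _ = (@tnth _ _)^~ j \o u); first exact: mu.
  by apply/funext => x; rewrite /= tnth_lshift.
rewrite (_ : _ \o _ = (@tnth _ _)^~ j \o v); first exact: mv.
by apply/funext => x; rewrite /= tnth_rshift.
Qed.

End IteratedIntegral.

(** * Integration over one trajectory *)

Section TrajectoryIntegral.
Context {R : realType} {n : nat}.
Notation traj := (@traj R n).
Local Open Scope ereal_scope.

(* Only the trajectories [mktraj n b e t] with [b <= e] matter: everything else in
   the type [traj] is never reached by the integrals, and nothing is assumed there. *)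
Definition meas_traj_fun (F : traj -> \bar R) :=
  forall b e, (b <= e)%N -> measurable_fun setT (fun t : (tlen n b e).-tuple R => F (mktraj n b e t)).

Definition jmeas d (T : measurableType d) (F : T -> traj -> \bar R) :=
  forall b e, (b <= e)%N ->
    measurable_fun setT (fun p : T * (tlen n b e).-tuple R => F p.1 (mktraj n b e p.2)).

(** Brings the nested sum over end and start times to the index set of pairs that [setint] uses for
    its shapes. *)
Lemma trajintE K (p : traj -> \bar R) :
  trajint K p = \sum_(q : 'I_K.+1 * 'I_K.+1 | (q.1 <= q.2)%N)
    iint (tlen n q.1 q.2) (fun t => p (mktraj n q.1 q.2 t)).
Proof.
rewrite -(pair_big_dep xpredT (fun b e : 'I_K.+1 => (b <= e)%N)
  (fun b e : 'I_K.+1 => iint (tlen n b e) (fun t => p (mktraj n b e t)))) /=.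
rewrite (exchange_big_dep xpredT) //=; apply: eq_bigr => e _.
rewrite (big_ord_widen_cond K.+1 xpredT
  (fun b => iint (tlen n b e) (fun t => p (mktraj n b e t)))) //.
Qed.

Lemma trajint_ge0 K (F : traj -> \bar R) : (forall X, 0 <= F X) -> 0 <= trajint K F.
Proof. by move=> F0; rewrite trajintE; apply: sume_ge0 => q _; exact: iint_ge0. Qed.

Lemma eq_trajint K (F G : traj -> \bar R) :
  (forall b e (t : (tlen n b e).-tuple R), (b <= e)%N -> F (mktraj n b e t) = G (mktraj n b e t)) ->
  trajint K F = trajint K G.
Proof.
move=> FG; rewrite !trajintE; apply: eq_bigr => q q12.
by apply: eq_iint => t; exact: FG.
Qed.

Lemma measurable_trajint K d (T : measurableType d) (F : T -> traj -> \bar R) :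
  jmeas F -> (forall x X, 0 <= F x X) -> measurable_fun setT (fun x => trajint K (F x)).
Proof.
move=> mF F0; under eq_fun do rewrite trajintE big_mkcond.
apply: emeasurable_sum => q; case: (boolP (q.1 <= q.2)%N) => // q12.
by apply: (@measurable_iint _ _ _ _ (fun x t => F x (mktraj n q.1 q.2 t))) => //; exact: mF.
Qed.

Lemma trajintD K (F G : traj -> \bar R) :
  meas_traj_fun F -> (forall t, 0 <= F t) -> meas_traj_fun G -> (forall t, 0 <= G t) ->
  trajint K (fun X => F X + G X) = trajint K F + trajint K G.
Proof.
move=> mF F0 mG G0; rewrite !trajintE -big_split; apply: eq_bigr => q q12.
by apply: iintD => //; [exact: mF | exact: mG].
Qed.

Lemma trajintZ K (c : \bar R) (F : traj -> \bar R) : 0 <= c ->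
  meas_traj_fun F -> (forall t, 0 <= F t) ->
  trajint K (fun X => c * F X) = c * trajint K F.
Proof.
move=> c0 mF F0; rewrite !trajintE ge0_sume_distrr; last by move=> *; exact: iint_ge0.
by apply: eq_bigr => q q12; apply: iintZ => //; exact: mF.
Qed.

Lemma trajint_nneseries K (F : nat -> traj -> \bar R) :
  (forall i, meas_traj_fun (F i)) -> (forall i t, 0 <= F i t) ->
  trajint K (fun t => \sum_(i <oo) F i t) = \sum_(i <oo) trajint K (F i).
Proof.
move=> mF F0; rewrite trajintE; under eq_eseriesr do rewrite trajintE.
rewrite nneseries_sum; last by move=> *; exact: iint_ge0.
apply: eq_bigr => q q12; apply: (@iint_nneseries _ _ (fun i t => F i (mktraj n q.1 q.2 t))) => //.
by move=> i; exact: mF.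
Qed.

Lemma iint_trajint N K (G : N.-tuple R -> traj -> \bar R) :
  jmeas G -> (forall s X, 0 <= G s X) ->
  iint N (fun s => trajint K (G s)) = trajint K (fun X => iint N (G ^~ X)).
Proof.
move=> mG G0; rewrite trajintE; under eq_iint do rewrite trajintE.
rewrite iint_sum //; last first.
- by move=> *; exact: iint_ge0.
- move=> q q12.
  by apply: (@measurable_iint _ _ _ _ (fun s t => G s (mktraj n q.1 q.2 t))) => //; exact: mG.
by apply: eq_bigr => q q12; rewrite (iint_swap (mG _ _ q12)).
Qed.

Lemma trajint_sum K (I : Type) (s : seq I) (P : pred I) (F : I -> traj -> \bar R) :
  (forall i, P i -> meas_traj_fun (F i)) -> (forall i X, P i -> 0 <= F i X) ->
  trajint K (fun X => \sum_(i <- s | P i) F i X) = \sum_(i <- s | P i) trajint K (F i).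
Proof.
move=> mF F0; under eq_bigr do rewrite trajintE.
rewrite trajintE exchange_big; apply: eq_bigr => q q12.
apply: (iint_sum _ (F := fun i t => F i (mktraj n q.1 q.2 t))) => i *; last exact: F0.
exact: mF.
Qed.

(** Tonelli for two trajectories: for each shape of the outer one, its coordinate integral passes
    inside the inner trajectory integral, and the finite sum over shapes follows. *)
Lemma trajint_swap K K' (G : traj -> traj -> \bar R) :
  (forall b e, (b <= e)%N ->
     jmeas (fun (t : (tlen n b e).-tuple R) X => G (mktraj n b e t) X)) ->
  (forall X Y, 0 <= G X Y) ->
  trajint K (fun X => trajint K' (G X)) = trajint K' (fun Y => trajint K (G ^~ Y)).
Proof.
move=> mG G0; rewrite trajintE.
under eq_bigr => q q12 do
  rewrite (@iint_trajint _ _ (fun t => G (mktraj n q.1 q.2 t)) (mG _ _ q12)) //.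
rewrite -trajint_sum.
- by apply: eq_trajint => b e t be; rewrite trajintE.
- move=> q q12 b e be.
  apply: (@measurable_iint _ _ _ _ (fun (s : (tlen n b e).-tuple R)
    (t : (tlen n q.1 q.2).-tuple R) => G (mktraj n q.1 q.2 t) (mktraj n b e s))) => //.
  by apply: (measurable_comp2 (mG _ _ q12 b e be)).
- by move=> *; exact: iint_ge0.
Qed.

End TrajectoryIntegral.

(** * Measurability of functions of lists, and iterated integrals over lists *)

Section ListFunctionals.
Context {R : realType} {n : nat}.
Notation traj := (@traj R n).
Local Open Scope ereal_scope.

(* Joint measurability in a parameter x and a list of trajectories of shape sh,
   curried so that the parameter space absorbs the trajectories one by one: fixing
   the head of the list gives again a function of this kind. *)
Fixpoint pmeas (sh : seq (nat * nat)) d (T : measurableType d) (F : T -> seq traj -> \bar R) :=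
  match sh with
  | [::] => measurable_fun setT (fun x => F x [::])
  | (b, e) :: sh' =>
      pmeas sh' (fun (p : T * (tlen n b e).-tuple R) S => F p.1 (mktraj n b e p.2 :: S))
  end.

Definition pmeas_fun d (T : measurableType d) (F : T -> seq traj -> \bar R) :=
  forall sh : seq (nat * nat), all (fun q => q.1 <= q.2)%N sh -> pmeas sh F.

Definition meas_set_fun (G : seq traj -> \bar R) := pmeas_fun (fun _ : unit => G).

Lemma pmeas_precomp sh d d' (T : measurableType d) (T' : measurableType d') (u : T' -> T)
    (F : T -> seq traj -> \bar R) :
  measurable_fun setT u -> pmeas sh F -> pmeas sh (fun x => F (u x)).
Proof.
elim: sh d d' T T' u F => [|[b e] sh IH] d d' T T' u F mu /= mF.
  exact: (measurable_precomp mF mu).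
apply: (IH _ _ _ _ (fun p : T' * (tlen n b e).-tuple R => (u p.1, p.2)) _ _ mF).
by apply: measurable_fun_pair => //; exact: measurableT_comp.
Qed.

Lemma pmeas_fun_precomp d d' (T : measurableType d) (T' : measurableType d') (u : T' -> T)
    (F : T -> seq traj -> \bar R) :
  measurable_fun setT u -> pmeas_fun F -> pmeas_fun (fun x => F (u x)).
Proof. by move=> mu mF sh okb; apply: pmeas_precomp => //; exact: mF. Qed.

Lemma pmeas_fun_cons d (T : measurableType d) (F : T -> seq traj -> \bar R) b e : (b <= e)%N ->
  pmeas_fun F ->
  pmeas_fun (fun (p : T * (tlen n b e).-tuple R) S => F p.1 (mktraj n b e p.2 :: S)).
Proof. by move=> be mF sh oks; apply: (mF ((b, e) :: sh)); rewrite /= be. Qed.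

Lemma pmeas_fun_section d (T : measurableType d) (F : T -> seq traj -> \bar R) x :
  pmeas_fun F -> meas_set_fun (F x).
Proof. by move=> mF; apply: (pmeas_fun_precomp (u := fun=> x) _ mF). Qed.

Lemma pmeas_const d (T : measurableType d) (F : seq traj -> \bar R) :
  meas_set_fun F -> pmeas_fun (fun _ : T => F).
Proof. by move=> mF; apply: (pmeas_fun_precomp (u := fun=> tt) _ mF). Qed.

Lemma meas_set_fun_cons (G : seq traj -> \bar R) b e : (b <= e)%N -> meas_set_fun G ->
  pmeas_fun (fun (t : (tlen n b e).-tuple R) S => G (mktraj n b e t :: S)).
Proof.
move=> be /(pmeas_fun_cons be); apply: (pmeas_fun_precomp (u := fun t => (tt, t))).
exact: measurable_fun_pair.
Qed.

Lemma meas_set_fun_tail (G : seq traj -> \bar R) b e (t : (tlen n b e).-tuple R) : (b <= e)%N ->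
  meas_set_fun G -> meas_set_fun (fun S => G (mktraj n b e t :: S)).
Proof. by move=> be mG; exact: pmeas_fun_section (meas_set_fun_cons be mG). Qed.

(** The passage from one flat coordinate vector, as in [set_meas], to the curried form: a block
    absorbed by the parameter is put back by concatenation, which is measurable and which [decode]
    undoes. *)
Lemma pmeas_decode sh d (T : measurableType d) (F : T -> seq traj -> \bar R) :
  measurable_fun setT (fun p : T * (shlen n sh).-tuple R => F p.1 (Defs.decode n sh p.2)) ->
  pmeas sh F.
Proof.
elim: sh d T F => [|[b e] sh IH] d T F mF /=.
  exact: (measurable_comp2 (u := id) (v := fun=> [tuple]) mF).
apply: IH => /=.
have := measurable_comp2 (T := ((T * (tlen n b e).-tuple R) * (shlen n sh).-tuple R)%type)
  (u := fun p => p.1.1) (v := fun p => [tuple of p.1.2 ++ p.2]) mF.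
rewrite /= (_ : (fun _ => _) = fun p : (T * (tlen n b e).-tuple R) * (shlen n sh).-tuple R =>
   F p.1.1 (mktraj n b e p.1.2 :: Defs.decode n sh p.2)).
  apply; first exact: measurableT_comp.
  by apply: measurable_cat => //; exact: measurableT_comp.
apply/funext => p; rewrite take_size_cat ?size_tuple//.
by rewrite drop_size_cat ?size_tuple.
Qed.

Lemma set_meas_meas_set_fun (g : seq traj -> \bar R) : set_meas g -> meas_set_fun g.
Proof.
move=> mg sh _; apply: pmeas_decode.
by apply: (measurable_precomp (mg sh)).
Qed.

Lemma pmeas_fun_param d (T : measurableType d) (c : T -> \bar R) :
  measurable_fun setT c -> pmeas_fun (fun x _ => c x).
Proof.
move=> mc sh _; elim: sh d T c mc => [|[b e] sh IH] d T c mc //=.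
by apply: (IH _ _ (fun p => c p.1)); exact: measurableT_comp.
Qed.

Lemma pmeasD sh d (T : measurableType d) (F G : T -> seq traj -> \bar R) :
  pmeas sh F -> pmeas sh G -> pmeas sh (fun x S => F x S + G x S).
Proof.
elim: sh d T F G => [|[b e] sh IH] d T F G /= mF mG; first exact: emeasurable_funD.
exact: IH mF mG.
Qed.

Lemma pmeas_funD d (T : measurableType d) (F G : T -> seq traj -> \bar R) :
  pmeas_fun F -> pmeas_fun G -> pmeas_fun (fun x S => F x S + G x S).
Proof. by move=> mF mG sh oks; apply: pmeasD; [exact: mF | exact: mG]. Qed.

Lemma pmeasM sh d (T : measurableType d) (F G : T -> seq traj -> \bar R) :
  pmeas sh F -> pmeas sh G -> pmeas sh (fun x S => F x S * G x S).
Proof.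
elim: sh d T F G => [|[b e] sh IH] d T F G /= mF mG; first exact: emeasurable_funM.
exact: IH mF mG.
Qed.

Lemma pmeas_funM d (T : measurableType d) (F G : T -> seq traj -> \bar R) :
  pmeas_fun F -> pmeas_fun G -> pmeas_fun (fun x S => F x S * G x S).
Proof. by move=> mF mG sh oks; apply: pmeasM; [exact: mF | exact: mG]. Qed.

Lemma pmeas_iint N sh d (T : measurableType d) (F : T -> N.-tuple R -> seq traj -> \bar R) :
  pmeas sh (fun p : T * N.-tuple R => F p.1 p.2) -> (forall x y S, 0 <= F x y S) ->
  pmeas sh (fun x S => iint N (fun y => F x y S)).
Proof.
elim: sh d T F => [|[b e] sh IH] d T F /= mF F0.
  by apply: (@measurable_iint _ _ _ _ (fun x y => F x y [::])).
apply: (IH _ _ (fun (p : T * (tlen n b e).-tuple R) y S => F p.1 y (mktraj n b e p.2 :: S))) => //.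
apply: (pmeas_precomp (u := fun p : (T * (tlen n b e).-tuple R) * N.-tuple R =>
  ((p.1.1, p.2), p.1.2)) _ mF).
apply: measurable_fun_pair; last exact: measurableT_comp.
by apply: measurable_fun_pair => //; exact: measurableT_comp.
Qed.

(** The closure property that lets a functional stand inside a further integral: the variable of
    that integral plays the role of the parameter [x]. *)
Definition meas_functional (J : (seq traj -> \bar R) -> \bar R) :=
  forall d (T : measurableType d) (F : T -> seq traj -> \bar R),
    pmeas_fun F -> (forall x S, 0 <= F x S) -> measurable_fun setT (fun x => J (F x)).

Lemma meas_functional_cons J (G : seq traj -> \bar R) :
  meas_functional J -> meas_set_fun G -> (forall S, 0 <= G S) ->
  meas_traj_fun (fun X => J (fun S => G (X :: S))).
Proof. by move=> mJ mG G0 b e be; apply: mJ => //; exact: meas_set_fun_cons. Qed.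

Section Lint.
Variable K : nat.

(** The order-[m] term of the set integral without its [1/m!], written one trajectory at a time so
    that inductions can peel off the head. *)
Fixpoint lint (m : nat) (G : seq traj -> \bar R) : \bar R :=
  if m is m'.+1 then trajint K (fun X => lint m' (fun S => G (X :: S))) else G [::].

Lemma lint_ge0 m G : (forall S, 0 <= G S) -> 0 <= lint m G.
Proof. by elim: m G => [|m IH] G G0 //=; apply: trajint_ge0 => X; exact: IH. Qed.

Lemma measurable_lint m : meas_functional (lint m).
Proof.
elim: m => [|m IH] d T F mF F0 /=; first exact: (mF [::]).
apply: (@measurable_trajint _ _ _ _ _ (fun x X => lint m (fun S => F x (X :: S)))).
  by move=> b e be; apply: IH => //; exact: pmeas_fun_cons.
by move=> x X; exact: lint_ge0.
Qed.

Lemma lintD m F G : meas_set_fun F -> (forall S, 0 <= F S) ->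
  meas_set_fun G -> (forall S, 0 <= G S) ->
  lint m (fun S => F S + G S) = lint m F + lint m G.
Proof.
elim: m F G => [|m IH] F G mF F0 mG G0 //=.
rewrite -trajintD; try (move=> X; exact: lint_ge0);
  try (apply: meas_functional_cons => //; exact: measurable_lint).
apply: eq_trajint => b e t be; apply: IH => //; exact: meas_set_fun_tail.
Qed.

Lemma lintZ m (c : \bar R) F : 0 <= c -> meas_set_fun F -> (forall S, 0 <= F S) ->
  lint m (fun S => c * F S) = c * lint m F.
Proof.
move=> c0; elim: m F => [|m IH] F mF F0 //=.
rewrite -trajintZ //; try (move=> X; exact: lint_ge0);
  try (apply: meas_functional_cons => //; exact: measurable_lint).
apply: eq_trajint => b e t be; apply: IH => //; exact: meas_set_fun_tail.
Qed.

End Lint.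
End ListFunctionals.

(** * The set integral as a series of iterated trajectory integrals *)

Section SetIntegral.
Context {R : realType} {n : nat}.
Notation traj := (@traj R n).
Local Open Scope ereal_scope.

Lemma measurable_iint_decode sh d (T : measurableType d) (F : T -> seq traj -> \bar R) :
  pmeas sh F -> (forall x S, 0 <= F x S) ->
  measurable_fun setT (fun x => iint (shlen n sh) (fun t => F x (Defs.decode n sh t))).
Proof.
elim: sh d T F => [|[b e] sh IH] d T F //= mF F0.
under eq_fun do rewrite (iint_cat (N := tlen n b e) (N' := shlen n sh)).
apply: (@measurable_iint _ _ _ _ (fun x (s : (tlen n b e).-tuple R) =>
  iint (shlen n sh) (fun t => F x (_ (take (tlen n b e) (s ++ t)) ::
    Defs.decode n sh (drop (tlen n b e) (s ++ t)))))); last by move=> *; exact: iint_ge0.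
have := IH _ _ _ mF (fun _ _ => F0 _ _); congr measurable_fun.
apply/funext => p /=; apply: eq_iint => t.
by rewrite take_size_cat ?size_tuple// drop_size_cat ?size_tuple.
Qed.

(** Splitting a shape into head and tail splits the flat vector into two blocks; the sum over tail
    shapes is then moved inside the integral over the head block, which is where measurability and
    nonnegativity enter. *)
Lemma sum_iint_decode K m (G : seq traj -> \bar R) :
  meas_set_fun G -> (forall S, 0 <= G S) ->
  \sum_(sh : m.-tuple ('I_K.+1 * 'I_K.+1) | all (fun p : 'I_K.+1 * 'I_K.+1 => (p.1 <= p.2)%N) sh)
    iint (shlen n (shape_of sh)) (fun t => G (Defs.decode n (shape_of sh) t)) = lint K m G.
Proof.
elim: m G => [|m IH] G mG G0.
  by rewrite (big_pred1 [tuple]) // => sh; rewrite (tuple0 sh) /= eqxx.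
rewrite (reindex (fun p : ('I_K.+1 * 'I_K.+1) * m.-tuple ('I_K.+1 * 'I_K.+1) =>
  [tuple of p.1 :: p.2])); last first.
  exists (fun t => (thead t, [tuple of behead t])).
    by move=> [q sh] _ /=; rewrite theadE; congr pair; exact: val_inj.
  by move=> t _ /=; rewrite -tuple_eta.
rewrite -(pair_big_dep (fun q : 'I_K.+1 * 'I_K.+1 => (q.1 <= q.2)%N)
  (fun _ (sh : m.-tuple ('I_K.+1 * 'I_K.+1)) =>
     all (fun p : 'I_K.+1 * 'I_K.+1 => (p.1 <= p.2)%N) sh)
  (fun q sh => iint (shlen n (shape_of (q :: sh)))
     (fun t => G (Defs.decode n (shape_of (q :: sh)) t)))) /=.
rewrite trajintE; apply: eq_bigr => q q12.
under [RHS]eq_iint => s.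
  rewrite -IH //; last exact: meas_set_fun_tail.
  over.
have okshape (sh : m.-tuple ('I_K.+1 * 'I_K.+1)) :
    all (fun p : 'I_K.+1 * 'I_K.+1 => (p.1 <= p.2)%N) sh ->
    all (fun p => p.1 <= p.2)%N (shape_of sh).
  by rewrite /shape_of all_map.
rewrite iint_sum; last first.
- by move=> *; exact: iint_ge0.
- move=> sh oksh; apply: (measurable_iint_decode (F := fun (s : (tlen n q.1 q.2).-tuple R) S =>
    G (mktraj n q.1 q.2 s :: S))) => //.
  by apply: meas_set_fun_cons => //; exact: okshape.
apply: eq_bigr => sh oksh.
rewrite (iint_cat (N := tlen n q.1 q.2) (N' := shlen n (shape_of sh))).
apply: eq_iint => s; apply: eq_iint => t.
by rewrite /= take_size_cat ?size_tuple// drop_size_cat ?size_tuple.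
Qed.

Lemma setintE K (G : seq traj -> \bar R) : meas_set_fun G -> (forall S, 0 <= G S) ->
  setint K G = \sum_(m <oo) ((m`!%:R : R)^-1)%:E * lint K m G.
Proof.
by move=> mG G0; apply: eq_eseriesr => m _; rewrite sum_iint_decode.
Qed.

Lemma invfact_ge0 m : 0 <= ((m`!%:R : R)^-1)%:E.
Proof. by rewrite lee_fin invr_ge0 ler0n. Qed.

Lemma setintD K (F G : seq traj -> \bar R) :
  meas_set_fun F -> (forall S, 0 <= F S) -> meas_set_fun G -> (forall S, 0 <= G S) ->
  setint K (fun S => F S + G S) = setint K F + setint K G.
Proof.
move=> mF F0 mG G0; rewrite !setintE //; first last.
- by move=> S; exact: adde_ge0.
- exact: pmeas_funD.
rewrite -nneseriesD; last first.
- by move=> *; apply: mule_ge0; [exact: invfact_ge0 | exact: lint_ge0].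
- by move=> *; apply: mule_ge0; [exact: invfact_ge0 | exact: lint_ge0].
by apply: eq_eseriesr => m _; rewrite lintD// ge0_muleDr //; exact: lint_ge0.
Qed.

Lemma setintZ K (c : R) (F : seq traj -> \bar R) : (0 <= c)%R ->
  meas_set_fun F -> (forall S, 0 <= F S) ->
  setint K (fun S => c%:E * F S) = c%:E * setint K F.
Proof.
move=> c0 mF F0; rewrite !setintE //; first last.
- by move=> S; exact: mule_ge0.
- by apply: pmeas_funM => //; exact: pmeas_fun_param.
rewrite -nneseriesZl; last first.
  by move=> *; apply: mule_ge0; [exact: invfact_ge0 | exact: lint_ge0].
by apply: eq_eseriesr => m _; rewrite lintZ// muleCA.
Qed.

Lemma setint_sum K (I : Type) (s : seq I) (P : pred I) (F : I -> seq traj -> \bar R) :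
  (forall i, P i -> meas_set_fun (F i)) -> (forall i S, P i -> 0 <= F i S) ->
  setint K (fun S => \sum_(i <- s | P i) F i S) = \sum_(i <- s | P i) setint K (F i).
Proof.
move=> mF F0.
(* Measurability of the partial sum is carried through the induction, since additivity requires it
   at every step. *)
suff: meas_set_fun (fun S => \sum_(i <- s | P i) F i S) /\
  setint K (fun S => \sum_(i <- s | P i) F i S) = \sum_(i <- s | P i) setint K (F i) by case.
elim: s => [|i s [mIH IH]].
  rewrite big_nil (_ : (fun _ => _) = fun=> 0); last by apply/funext => S; rewrite big_nil.
  have m0 : meas_set_fun (fun _ : seq traj => 0 : \bar R) by exact: pmeas_fun_param.
  split => //; have := @setintZ K 0%R (fun=> 0) (lexx _) m0 (fun=> lexx _).
  by rewrite !mul0e.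
rewrite big_cons (_ : (fun _ => _) = (fun S => if P i then F i S + \sum_(j <- s | P j) F j S
   else \sum_(j <- s | P j) F j S)); last by apply/funext => S; rewrite big_cons.
case: (boolP (P i)) => // Pi; split; first by apply: pmeas_funD => //; exact: mF.
rewrite setintD ?IH //; first exact: mF.
  by move=> S; exact: F0.
by move=> S; apply: sume_ge0 => j; exact: F0.
Qed.

End SetIntegral.

(** * Multi-Bernoulli densities by recursion over components *)

Section MultiBernoulli.
Context {R : realType} {n : nat}.
Notation traj := (@traj R n).
Local Open Scope ereal_scope.

Definition valid_traj (X : traj) := (tb X <= te X)%N && (size (tx X) == (te X - tb X).+1).

Lemma valid_mktraj b e (t : seq R) : (b <= e)%N -> valid_traj (mktraj n b e t).
Proof. by move=> be; rewrite /valid_traj /= be size_map size_iota eqxx. Qed.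

(** Makes measurability statements, which are phrased in coordinates, usable at a given valid
    trajectory. *)
Lemma valid_trajP (X : traj) : valid_traj X ->
  exists b e (t : (tlen n b e).-tuple R), (b <= e)%N /\ X = mktraj n b e t.
Proof.
case: X => [[b e] xs] /andP[/= be /eqP sxs].
(* Inverse of the block layout of [states]: flat position [i] is coordinate [i %% n] of state
   [i %/ n]. *)
pose t := [tuple nth 0%R (nth (state0 n) xs (i %/ n)) (i %% n) | i < tlen n b e].
exists b, e, t; split=> //; congr (_, _).
apply: (@eq_from_nth _ (state0 n)); first by rewrite size_map size_iota sxs.
move=> j jlt; rewrite (nth_map 0%N) ?size_iota -?sxs// nth_iota -?sxs// add0n.
apply: eq_from_tnth => i; rewrite tnth_mktuple.
have n0 : (0 < n)%N by exact: leq_ltn_trans (ltn_ord i).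
have jilt : (j * n + i < tlen n b e)%N.
  by rewrite /tlen -sxs (leq_trans (n := j.+1 * n)) ?leq_mul2r ?jlt ?orbT// mulSn addnC ltn_add2r.
rewrite (_ : (j * n + i)%N = Ordinal jilt) // -tnth_nth tnth_mktuple /=.
by rewrite divnMDl // divn_small // addn0 modnMDl modn_small // -tnth_nth.
Qed.

Lemma eq_lint K m (F G : seq traj -> \bar R) :
  (forall S, all valid_traj S -> F S = G S) -> lint K m F = lint K m G.
Proof.
elim: m F G => [|m IH] F G FG /=; first exact: FG.
apply: eq_trajint => b e t be; apply: IH => S vS; apply: FG.
by rewrite /= valid_mktraj.
Qed.

(* Weaker than [set_sym], which the expectation after the transition only satisfies
   on lists of valid trajectories (elsewhere Tonelli may fail). *)
Definition swap_sym (g : seq traj -> \bar R) :=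
  forall P X Y S, all valid_traj (P ++ [:: X, Y & S]) ->
    g (P ++ [:: X, Y & S]) = g (P ++ [:: Y, X & S]).

Lemma swap_sym_cons (g : seq traj -> \bar R) X : valid_traj X -> swap_sym g ->
  swap_sym (fun S => g (X :: S)).
Proof. by move=> vX sg P Y Z S vS; apply: (sg (X :: P)); rewrite /= vX. Qed.

(* The sum of [H X S'] over all ways to take one element X out of S, leaving S'. *)
Fixpoint pick_sum (H : traj -> seq traj -> \bar R) (S : seq traj) : \bar R :=
  if S is X :: S' then H X S' + pick_sum (fun Y S'' => H Y (X :: S'')) S' else 0.

Lemma pick_sum_ge0 H S : (forall X S, 0 <= H X S) -> 0 <= pick_sum H S.
Proof. by elim: S H => [|X S IH] H H0 //=; apply: adde_ge0 => //; exact: IH. Qed.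

Lemma eq_pick_sum H H' S : all valid_traj S ->
  (forall X S, valid_traj X -> all valid_traj S -> H X S = H' X S) ->
  pick_sum H S = pick_sum H' S.
Proof.
elim: S H H' => [|X S IH] H H' //= /andP[vX vS] HH'; rewrite HH' //; congr (_ + _).
by apply: IH => // Y S' vY vS'; apply: HH' => //=; rewrite vX.
Qed.

(** The symmetry of [g] brings the picked element to the front, so that [g] sees it as the head
    whatever its position in [S]. *)
Lemma mul_pick_sum (g : seq traj -> \bar R) H S : all valid_traj S -> swap_sym g ->
  (forall X S, 0 <= H X S) ->
  g S * pick_sum H S = pick_sum (fun X S' => g (X :: S') * H X S') S.
Proof.
elim: S g H => [|X S IH] g H /=; first by rewrite mule0.
move=> /andP[vX vS] sg H0; rewrite ge0_muleDr //; last exact: pick_sum_ge0.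
congr (_ + _); rewrite (IH (fun S => g (X :: S))) //; last exact: swap_sym_cons.
apply: eq_pick_sum => // Y S' vY vS'; congr (_ * _).
by apply: (sg [::]); rewrite /= vX vY.
Qed.

Lemma pmeas_pick_sum d (T : measurableType d) (H : T -> traj -> seq traj -> \bar R) :
  (forall b e, (b <= e)%N ->
     pmeas_fun (fun (p : T * (tlen n b e).-tuple R) S => H p.1 (mktraj n b e p.2) S)) ->
  pmeas_fun (fun x => pick_sum (H x)).
Proof.
move=> mH sh; elim: sh d T H mH => [|[b e] sh IH] d T H mH /= => [_|/andP[be oksh]].
  exact: measurable_cst.
apply: pmeasD; first exact: mH.
apply: (IH _ _ (fun (p : T * (tlen n b e).-tuple R) Y S => H p.1 Y (mktraj n b e p.2 :: S))) => //.
move=> b' e' be'; have := pmeas_fun_cons be (mH _ _ be').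
(* The skipped trajectory has been absorbed before the picked one, while the hypothesis on [H]
   absorbs the picked one first; [u] exchanges the two. *)
apply: (pmeas_fun_precomp (u := fun p : (T * (tlen n b e).-tuple R) * (tlen n b' e').-tuple R =>
  ((p.1.1, p.2), p.1.2))).
apply: measurable_fun_pair; last exact: measurableT_comp.
by apply: measurable_fun_pair => //; exact: measurableT_comp.
Qed.

(** Each of the [m.+1] positions contributes the same integral: Tonelli makes the picked variable
    the outermost one, and the order of the others is kept, so [H] need not be symmetric. *)
Lemma lint_pick_sum K m (H : traj -> seq traj -> \bar R) :
  (forall b e, (b <= e)%N ->
     pmeas_fun (fun (t : (tlen n b e).-tuple R) S => H (mktraj n b e t) S)) ->
  (forall X S, 0 <= H X S) ->
  lint K m.+1 (pick_sum H) = (m.+1%:R : R)%:E * trajint K (fun X => lint K m (H X)).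
Proof.
elim: m H => [|m IH] H mH H0.
  by rewrite mul1e /=; apply: eq_trajint => b e t be; rewrite adde0.
have mtail b e (t : (tlen n b e).-tuple R) : (b <= e)%N -> forall b' e', (b' <= e')%N ->
    pmeas_fun (fun (s : (tlen n b' e').-tuple R) S => H (mktraj n b' e' s) (mktraj n b e t :: S)).
  move=> be b' e' be'; have := pmeas_fun_cons be (mH _ _ be').
  by apply: (pmeas_fun_precomp (u := fun s => (s, t))); exact: measurable_fun_pair.
have msect b e (t : (tlen n b e).-tuple R) : (b <= e)%N -> meas_set_fun (H (mktraj n b e t)).
  by move=> be; exact: pmeas_fun_section (mH _ _ be).
have mpick b e (t : (tlen n b e).-tuple R) : (b <= e)%N ->
    meas_set_fun (pick_sum (fun Y S => H Y (mktraj n b e t :: S))).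
  move=> be; apply: (@pmeas_pick_sum _ unit (fun _ Y S => H Y (mktraj n b e t :: S))).
  move=> b' e' be'; apply: (pmeas_fun_precomp (u := snd) _ (mtail _ _ t be _ _ be')) => //.
(* Contribution of one pick [Y] from behind the head [X]. The induction hypothesis counts [m.+1] of
   them, and exchanging [X] with [Y] turns each into the contribution of picking the head. *)
pose B X := trajint K (fun Y => lint K m (fun S => H Y (X :: S))).
have B0 X : 0 <= B X by apply: trajint_ge0 => Y; exact: lint_ge0.
transitivity (trajint K (fun X => lint K m.+1 (H X) + (m.+1%:R : R)%:E * B X)).
  apply: eq_trajint => b e t be; rewrite /B.
  rewrite -(IH (fun Y S => H Y (mktraj n b e t :: S))) //; last exact: mtail.
  apply: (@lintD _ _ K m.+1 (H (mktraj n b e t))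
    (pick_sum (fun Y S => H Y (mktraj n b e t :: S)))) => //; [exact: msect | exact: mpick |].
  by move=> S; exact: pick_sum_ge0.
have mG b e : (b <= e)%N -> jmeas (fun (t : (tlen n b e).-tuple R) Y =>
    lint K m (fun S => H Y (mktraj n b e t :: S))).
  move=> be b' e' be'; apply: measurable_lint => //.
  have := pmeas_fun_cons be (mH _ _ be').
  by apply: (pmeas_fun_precomp (u := fun p => (p.2, p.1))); exact: measurable_fun_pair.
have mB : meas_traj_fun B.
  move=> b e be; apply: (@measurable_trajint _ _ _ _ _ (fun (t : (tlen n b e).-tuple R) Y =>
    lint K m (fun S => H Y (mktraj n b e t :: S)))); first exact: mG.
  by move=> *; exact: lint_ge0.
rewrite trajintD; last first.
- by move=> X; exact: mule_ge0.
- by move=> b e be; apply: emeasurable_funM => //; exact: mB.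
- by move=> X; exact: lint_ge0.
- move=> b e be; apply: (@measurable_lint _ _ K m.+1) => //; exact: mH.
rewrite trajintZ // [trajint K B]trajint_swap //; last by move=> *; exact: lint_ge0.
rewrite -[X in X + _]mul1e -ge0_muleDl //.
Qed.

Definition bcomp := (R * (traj -> R))%type.

(** The multi-Bernoulli density with the sum organised by components: the head component is either
    empty or takes one element of [S], and the remaining components share what is left. Agreement
    with [mb_dens] is [mb_dens_mbl]. *)
Fixpoint mbl (cs : seq bcomp) (S : seq traj) : \bar R :=
  match cs with
  | [::] => (size S == 0%N)%:R%:E
  | (r, f) :: cs' =>
      (1 - r)%:E * mbl cs' S + pick_sum (fun X S' => (r * f X)%:E * mbl cs' S') S
  end.

Fixpoint mbexp K (cs : seq bcomp) (g : seq traj -> \bar R) : \bar R :=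
  match cs with
  | [::] => g [::]
  | (r, f) :: cs' =>
      (1 - r)%:E * mbexp K cs' g +
      r%:E * trajint K (fun X => (f X)%:E * mbexp K cs' (fun S => g (X :: S)))
  end.

Definition bcomp_ok (c : bcomp) :=
  [/\ (0 <= c.1 <= 1)%R, (forall X, 0 <= c.2 X)%R & meas_traj_fun (fun X => (c.2 X)%:E)].

Fixpoint all_ok (cs : seq bcomp) : Prop :=
  if cs is c :: cs' then bcomp_ok c /\ all_ok cs' else True.

Lemma mbl_ge0 cs S : all_ok cs -> 0 <= mbl cs S.
Proof.
elim: cs S => [|[r f] cs IH] S /=; first by rewrite lee_fin.
move=> [[/= /andP[r0 r1] f0 _] okcs]; apply: adde_ge0.
  by rewrite mule_ge0 ?IH// lee_fin subr_ge0.
by apply: pick_sum_ge0 => X S'; rewrite mule_ge0 ?IH// lee_fin mulr_ge0.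
Qed.

Lemma mbexp_ge0 K cs g : all_ok cs -> (forall S, 0 <= g S) -> 0 <= mbexp K cs g.
Proof.
elim: cs g => [|[r f] cs IH] g //= [[/= /andP[r0 r1] f0 _] okcs] g0; apply: adde_ge0.
  by rewrite mule_ge0 ?IH// lee_fin subr_ge0.
rewrite mule_ge0 //; apply: trajint_ge0 => X.
by rewrite mule_ge0 ?IH// lee_fin.
Qed.

Lemma measurable_mbl cs : all_ok cs -> meas_set_fun (mbl cs).
Proof.
elim: cs => [|[r f] cs IH] /=.
  move=> _ [|[b e] sh] oksh /=; first exact: measurable_cst.
  apply: (pmeas_fun_param (c := fun=> 0)); last by case/andP: oksh.
  exact: measurable_cst.
move=> [[_ _ /= mf] okcs]; apply: pmeas_funD.
  by apply: pmeas_funM; [exact: pmeas_fun_param | exact: IH].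
apply: (@pmeas_pick_sum _ unit (fun _ X S' => (r * f X)%:E * mbl cs S')) => b e be.
apply: pmeas_funM; last exact/pmeas_const/IH.
apply: (pmeas_fun_param (c := fun p : unit * (tlen n b e).-tuple R => (r * f (mktraj n b e p.2))%:E)).
under eq_fun do rewrite EFinM.
by apply: emeasurable_funM => //; apply: (measurable_precomp (mf b e be)).
Qed.

Lemma measurable_mbexp K cs : all_ok cs -> meas_functional (mbexp K cs).
Proof.
elim: cs => [|[r f] cs IH] /=; first by move=> _ d T F mF _; exact: (mF [::]).
move=> [[_ /= f0 mf] okcs] d T F mF F0; apply: emeasurable_funD.
  by apply: emeasurable_funM => //; exact: IH.
apply: emeasurable_funM => //.
apply: (@measurable_trajint _ _ _ _ _ (fun x X => (f X)%:E * mbexp K cs (fun S => F x (X :: S)))).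
  move=> b e be; apply: emeasurable_funM; first exact: (measurable_precomp (mf b e be)).
  by apply: (IH okcs) => //; exact: pmeas_fun_cons.
by move=> x X; rewrite mule_ge0 ?lee_fin ?f0// mbexp_ge0.
Qed.

End MultiBernoulli.

(** * Set integrals against multi-Bernoulli densities *)

Section MultiBernoulliIntegral.
Context {R : realType} {n : nat}.
Notation traj := (@traj R n).
Local Open Scope ereal_scope.

Lemma eq_mbexp K cs (F G : seq traj -> \bar R) :
  (forall S, all valid_traj S -> F S = G S) -> mbexp K cs F = mbexp K cs G.
Proof.
elim: cs F G => [|[r f] cs IH] F G FG /=; first exact: FG.
rewrite (IH F G) //; congr (_ + _ * _); apply: eq_trajint => b e t be.
by congr (_ * _); apply: IH => S vS; apply: FG; rewrite /= valid_mktraj.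
Qed.

Lemma mul_mbl_cons r f cs (g : seq traj -> \bar R) S : all_ok ((r, f) :: cs) ->
  all valid_traj S -> swap_sym g -> (forall S, 0 <= g S) ->
  g S * mbl ((r, f) :: cs) S = (1 - r)%:E * (g S * mbl cs S) +
    pick_sum (fun X S' => (r * f X)%:E * (g (X :: S') * mbl cs S')) S.
Proof.
move=> /= [[/= /andP[r0 r1] f0 mf] okcs] vS sg g0.
have H0 X S' : 0 <= (r * f X)%:E * mbl cs S' by rewrite mule_ge0 ?mbl_ge0// lee_fin mulr_ge0.
rewrite ge0_muleDr; last 2 first.
- by rewrite mule_ge0 ?mbl_ge0// lee_fin subr_ge0.
- exact: pick_sum_ge0.
rewrite muleCA mul_pick_sum //; congr (_ + _).
by apply: eq_pick_sum => // X S' _ _; rewrite muleCA.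
Qed.

Lemma setint_mbl K cs (g : seq traj -> \bar R) : all_ok cs ->
  meas_set_fun g -> swap_sym g -> (forall S, 0 <= g S) ->
  setint K (fun S => g S * mbl cs S) = mbexp K cs g.
Proof.
move=> okcs mg sg g0.
have mgm (cs' : seq (@bcomp R n)) (g' : seq traj -> \bar R) :
    all_ok cs' -> meas_set_fun g' -> meas_set_fun (fun S => g' S * mbl cs' S).
  by move=> okcs' mg'; apply: pmeas_funM => //; exact: measurable_mbl.
have g0m cs' (g' : seq traj -> \bar R) S :
    all_ok cs' -> (forall S, 0 <= g' S) -> 0 <= g' S * mbl cs' S.
  by move=> okcs' g'0; rewrite mule_ge0 ?mbl_ge0.
elim: cs okcs g mg sg g0 => [|[r f] cs IH] okcs g mg sg g0.
  rewrite setintE; [|exact: mgm|by move=> S; exact: g0m].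
  rewrite nneseries_recl //; last first.
    by move=> m _; rewrite mule_ge0 ?invfact_ge0 ?lint_ge0// => S; exact: g0m.
  rewrite /= invr1 mul1e mule1 -[RHS]adde0; congr (_ + _).
  apply: eseries0 => -[|m] // _ _; rewrite -[RHS](mule0 ((m.+1`!%:R : R)^-1)%:E); congr (_ * _).
  (* With no component left, the density vanishes on nonempty lists. Writing the zero integrand as
     [0 * 0] lets homogeneity evaluate the integral. *)
  transitivity (lint K m.+1 (fun S : seq traj => 0 * 0)); last first.
    rewrite lintZ ?mul0e //; exact: pmeas_fun_param.
  elim: m => [|m _] /=; apply: eq_trajint => *; first by rewrite mule0 mul0e.
  apply: eq_trajint => *; apply: eq_lint => S _; by rewrite mule0 mul0e.
have okcs' := okcs; case: okcs' => -[/= /andP[r0 r1] f0 mf] okcs'.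
pose H (X : traj) S := (r * f X)%:E * (g (X :: S) * mbl cs S).
have H0 X S : 0 <= H X S by rewrite !mule_ge0 ?mbl_ge0 // lee_fin mulr_ge0.
have gm0 X S : 0 <= g (X :: S) * mbl cs S by rewrite mule_ge0 ?mbl_ge0.
have mtail b e (t : (tlen n b e).-tuple R) : (b <= e)%N ->
    meas_set_fun (fun S => g (mktraj n b e t :: S) * mbl cs S).
  by move=> be; apply: (mgm cs (fun S => g (mktraj n b e t :: S))) => //; exact: meas_set_fun_tail.
have mf' : meas_traj_fun (fun X => (r * f X)%:E).
  by move=> b e be; under eq_fun do rewrite EFinM; apply: emeasurable_funM => //; exact: mf.
have mg' b e : (b <= e)%N -> pmeas_fun (fun (t : (tlen n b e).-tuple R) S =>
    g (mktraj n b e t :: S) * mbl cs S).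
  move=> be; apply: pmeas_funM; first exact: meas_set_fun_cons.
  exact/pmeas_const/measurable_mbl.
have mH b e : (b <= e)%N -> pmeas_fun (fun (t : (tlen n b e).-tuple R) S => H (mktraj n b e t) S).
  move=> be; apply: pmeas_funM; last exact: mg'.
  exact: (pmeas_fun_param (mf' _ _ be)).
have mpH : meas_set_fun (pick_sum H).
  apply: (@pmeas_pick_sum _ _ _ unit (fun=> H)) => b e be.
  exact: (pmeas_fun_precomp (u := snd) _ (mH _ _ be)).
have mL m : meas_traj_fun (fun X => lint K m (fun S => g (X :: S) * mbl cs S)).
  by move=> b e be; apply: measurable_lint => //; exact: mg'.
have L0 m X : 0 <= lint K m (fun S => g (X :: S) * mbl cs S) by exact: lint_ge0.
transitivity (setint K (fun S => (1 - r)%:E * (g S * mbl cs S) + pick_sum H S)).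
  rewrite setintE; [|exact: (mgm ((r, f) :: cs))|by move=> S; exact: (g0m ((r, f) :: cs))].
  rewrite setintE; last 2 first.
  - apply: pmeas_funD => //; apply: pmeas_funM; [exact: pmeas_fun_param | exact: mgm].
  - move=> S; apply: adde_ge0; last exact: pick_sum_ge0.
    by rewrite mule_ge0 ?g0m// lee_fin subr_ge0.
  by apply: eq_eseriesr => m _; congr (_ * _); apply: eq_lint => S vS; exact: mul_mbl_cons.
rewrite setintD //; first last.
- by move=> S; exact: pick_sum_ge0.
- by move=> S; rewrite mule_ge0 ?g0m// lee_fin subr_ge0.
- by apply: pmeas_funM; [exact: pmeas_fun_param | exact: mgm].
rewrite setintZ ?subr_ge0 ?IH //; [|exact: mgm|by move=> S; exact: g0m].
rewrite /=; congr (_ + _).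
rewrite setintE //; last by move=> S; exact: pick_sum_ge0.
(* The term of order 0 is zero, as nothing can be picked from the empty list; dropping it shifts the
   index so that order [m.+1] meets [lint_pick_sum]. *)
rewrite nneseries_recl //; last first.
  by move=> m _; rewrite mule_ge0 ?invfact_ge0 ?lint_ge0// => S; exact: pick_sum_ge0.
rewrite /= mule0 add0e -(nneseries_addn (f := fun m => _ * lint K m (pick_sum H)) 1); last first.
  by move=> m; rewrite mule_ge0 ?invfact_ge0 ?lint_ge0// => S; exact: pick_sum_ge0.
transitivity (\sum_(m <oo) trajint K (fun X => (r * f X)%:E *
    (((m`!%:R : R)^-1)%:E * lint K m (fun S => g (X :: S) * mbl cs S)))).
  apply: eq_eseriesr => m _; rewrite addn1 lint_pick_sum // muleA -EFinM.
  (* The cancellation [(m + 1) / (m + 1)! = 1 / m!], which restores the weights of a set integral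
     over the remaining elements. *)
  rewrite factS natrM invfM mulrAC mulVf ?pnatr_eq0// mul1r -trajintZ //; first last.
  - by move=> X; exact: lint_ge0.
  - by move=> b e be; apply: measurable_lint => //; exact: mH.
  apply: eq_trajint => b e t be; rewrite [RHS]muleCA; congr (_ * _).
  by rewrite /H lintZ // ?lee_fin ?mulr_ge0 //; exact: mtail.
rewrite -trajint_nneseries; last first.
- by move=> m X; rewrite !mule_ge0 ?invfact_ge0// lee_fin mulr_ge0.
- move=> m b e be; apply: emeasurable_funM; first exact: mf'.
  by apply: emeasurable_funM => //; exact: mL.
rewrite -trajintZ //; first last.
- by move=> X; rewrite mule_ge0 ?lee_fin ?mbexp_ge0.
- move=> b e be; apply: emeasurable_funM; first exact: mf.
  by apply: measurable_mbexp => //; exact: meas_set_fun_cons.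
apply: eq_trajint => b e t be; rewrite nneseriesZl; last first.
  by move=> m _; rewrite mule_ge0 ?invfact_ge0.
rewrite muleA -EFinM; congr (_ * _); rewrite -setintE //; last exact: mtail.
apply: (IH okcs' (fun S => g (mktraj n b e t :: S))) => //.
  exact: meas_set_fun_tail.
by apply: swap_sym_cons => //; exact: valid_mktraj.
Qed.

Lemma mbexpD K cs (F G : seq traj -> \bar R) : all_ok cs ->
  meas_set_fun F -> (forall S, 0 <= F S) -> meas_set_fun G -> (forall S, 0 <= G S) ->
  mbexp K cs (fun S => F S + G S) = mbexp K cs F + mbexp K cs G.
Proof.
elim: cs F G => [|[r f] cs IH] F G //= [[/= /andP[r0 r1] f0 mf] okcs] mF F0 mG G0.
have E0 H : (forall S, 0 <= H S) -> forall X : traj, 0 <= (f X)%:E * mbexp K cs (fun S => H (X :: S)).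
  by move=> H0 X; rewrite mule_ge0 ?lee_fin ?mbexp_ge0.
have mE H : meas_set_fun H -> (forall S, 0 <= H S) ->
    meas_traj_fun (fun X => (f X)%:E * mbexp K cs (fun S => H (X :: S))).
  move=> mH H0 b e be; apply: emeasurable_funM; first exact: mf.
  by apply: measurable_mbexp => //; exact: meas_set_fun_cons.
rewrite IH // ge0_muleDr ?mbexp_ge0// addeACA; congr (_ + _).
rewrite -ge0_muleDr; [|by apply: trajint_ge0; exact: E0..]; congr (_ * _).
rewrite -trajintD; [|exact: mE|exact: E0|exact: mE|exact: E0].
apply: eq_trajint => b e t be; rewrite -ge0_muleDr ?mbexp_ge0//; congr (_ * _).
by apply: IH => //; exact: meas_set_fun_tail.
Qed.

Lemma mbexpZ K cs (c : \bar R) (F : seq traj -> \bar R) : all_ok cs -> 0 <= c ->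
  meas_set_fun F -> (forall S, 0 <= F S) ->
  mbexp K cs (fun S => c * F S) = c * mbexp K cs F.
Proof.
move=> + c0; elim: cs F => [|[r f] cs IH] F //= [[/= /andP[r0 r1] f0 mf] okcs] mF F0.
have E0 X : 0 <= (f X)%:E * mbexp K cs (fun S => F (X :: S)).
  by rewrite mule_ge0 ?lee_fin ?mbexp_ge0.
rewrite ge0_muleDr; last 2 first.
- by rewrite mule_ge0 ?mbexp_ge0// lee_fin subr_ge0.
- by rewrite mule_ge0 ?trajint_ge0.
rewrite IH // muleCA [c * (r%:E * _)]muleCA; congr (_ + _ * _).
rewrite -trajintZ //; last first.
  move=> b e be; apply: emeasurable_funM; first exact: mf.
  by apply: measurable_mbexp => //; exact: meas_set_fun_cons.
apply: eq_trajint => b e t be; rewrite [RHS]muleCA; congr (_ * _).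
by apply: IH => //; exact: meas_set_fun_tail.
Qed.

Lemma mbexp_iint K cs N (F : N.-tuple R -> seq traj -> \bar R) : all_ok cs ->
  pmeas_fun F -> (forall y S, 0 <= F y S) ->
  mbexp K cs (fun S => iint N (fun y => F y S)) = iint N (fun y => mbexp K cs (F y)).
Proof.
elim: cs F => [|[r f] cs IH] F //= [[/= /andP[r0 r1] f0 mf] okcs] mF F0.
have mE : measurable_fun setT (fun y => mbexp K cs (F y)) by exact: measurable_mbexp.
have mE' : jmeas (fun (y : N.-tuple R) X => (f X)%:E * mbexp K cs (fun S => F y (X :: S))).
  move=> b e be; apply: emeasurable_funM; first exact: (measurable_precomp (mf _ _ be)).
  by apply: measurable_mbexp => //; exact: pmeas_fun_cons.
have E0 y X : 0 <= (f X)%:E * mbexp K cs (fun S => F y (X :: S)).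
  by rewrite mule_ge0 ?lee_fin ?mbexp_ge0.
rewrite iintD; first last.
- by move=> y; rewrite mule_ge0 ?trajint_ge0.
- by apply: emeasurable_funM => //; exact: (measurable_trajint _ mE' E0).
- by move=> y; rewrite mule_ge0 ?mbexp_ge0// lee_fin subr_ge0.
- exact: emeasurable_funM.
rewrite !iintZ ?lee_fin ?subr_ge0 //; first last.
- by move=> y; exact: mbexp_ge0.
- by move=> y; exact: trajint_ge0.
- exact: (measurable_trajint _ mE' E0).
rewrite IH // iint_trajint //; congr (_ + _ * _).
apply: eq_trajint => b e t be; rewrite iintZ ?lee_fin //; first last.
- by move=> y; exact: mbexp_ge0.
- apply: measurable_mbexp => //.
  have := pmeas_fun_cons be mF.
  by apply: (pmeas_fun_precomp (u := fun y => (y, t))); exact: measurable_fun_pair.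
congr (_ * _); apply: (IH (fun y S => F y (mktraj n b e t :: S))) => //.
have := pmeas_fun_cons be mF.
by apply: (pmeas_fun_precomp (u := fun y => (y, t))); exact: measurable_fun_pair.
Qed.

End MultiBernoulliIntegral.

(** * Extension of a trajectory by one state, in coordinates *)

Section Extension.
Context {R : realType} {n : nat}.
Notation traj := (@traj R n).
Local Open Scope ereal_scope.

Lemma measurable_nth N i : measurable_fun setT (fun t : N.-tuple R => nth 0%R t i).
Proof.
have [iN|Ni] := ltnP i N.
  rewrite (_ : (fun _ => _) = (fun t : N.-tuple R => tnth t (Ordinal iN))).
    exact: measurable_tnth.
  by apply/funext => t; rewrite (tnth_nth 0%R).
rewrite (_ : (fun _ => _) = cst 0%R) //.
by apply/funext => t; rewrite nth_default // size_tuple.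
Qed.

Lemma lastst_mktraj b e (t : seq R) : lastst (mktraj n b e t) = blk n t (e - b).
Proof. by rewrite /lastst -nth_last size_map size_iota (nth_map 0%N) ?size_iota // nth_iota. Qed.

Lemma measurable_lastst b e :
  measurable_fun setT (fun t : (tlen n b e).-tuple R => lastst (mktraj n b e t)).
Proof.
apply/measurable_fun_tnthP => i.
rewrite (_ : _ \o _ = fun t : (tlen n b e).-tuple R => nth 0%R t ((e - b) * n + i)).
  exact: measurable_nth.
by apply/funext => t; rewrite /= lastst_mktraj tnth_mktuple.
Qed.

Lemma tlenS b e : (b <= e)%N -> (tlen n b e + n = tlen n b e.+1)%N.
Proof. by move=> be; rewrite /tlen subSn // [RHS]mulSn addnC. Qed.

(** States are stored oldest first in consecutive blocks, so a new last state is a block appended at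
    the end. *)
Lemma ext_mktraj b e (t : (tlen n b e).-tuple R) (y : n.-tuple R) : (b <= e)%N ->
  ext (mktraj n b e t) y = mktraj n b e.+1 (t ++ y).
Proof.
move=> be; congr (_, _, _).
rewrite [RHS]/states subSn // -[X in iota 0 X]addn1 iotaD map_cat [map _ (iota _ 1)]/= cats1.
congr rcons.
  apply/eq_in_map => j; rewrite mem_iota /= add0n => jlt.
  apply: eq_from_tnth => i; rewrite !tnth_mktuple nth_cat size_tuple.
  rewrite (_ : (_ < _)%N) // /tlen (leq_trans (n := j.+1 * n)) ?leq_mul2r ?jlt ?orbT//.
  by rewrite mulSn addnC ltn_add2r.
apply: eq_from_tnth => i; rewrite tnth_mktuple nth_cat size_tuple add0n ltnNge leq_addr /=.
by rewrite addKn -tnth_nth.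
Qed.

(** The concatenated vector has length [tlen n b e + n], equal to [tlen n b e.+1] only through
    [tlenS]; the cast between the two tuple types must be measurable. *)
Lemma measurable_tcast N N' (eqN : N = N') :
  measurable_fun setT (fun t : N.-tuple R => tcast eqN t).
Proof. by case: N' / eqN; exact: measurable_id. Qed.

Lemma valid_ext (X : traj) y : valid_traj X -> valid_traj (ext X y).
Proof.
move=> /andP[be /eqP sX]; apply/andP; split; first by rewrite /= leqW.
by rewrite /= size_rcons sX subSn.
Qed.

Lemma pmeas_fun_ext d (T : measurableType d) (F : T -> seq traj -> \bar R) b e : (b <= e)%N ->
  pmeas_fun F ->
  pmeas_fun (fun (p : (T * (tlen n b e).-tuple R) * n.-tuple R) S =>
    F p.1.1 (ext (mktraj n b e p.1.2) p.2 :: S)).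
Proof.
move=> be mF; have := pmeas_fun_cons (leqW be) mF.
move=> /(pmeas_fun_precomp (u := fun p : (T * (tlen n b e).-tuple R) * n.-tuple R =>
  (p.1.1, tcast (tlenS be) [tuple of p.1.2 ++ p.2]))).
rewrite (_ : (fun _ S => F _ (mktraj n b e.+1 _ :: S)) =
  fun (p : (T * (tlen n b e).-tuple R) * n.-tuple R) S =>
    F p.1.1 (ext (mktraj n b e p.1.2) p.2 :: S)).
  apply; apply: measurable_fun_pair; first exact: measurableT_comp.
  apply: (measurable_precomp (measurable_tcast (tlenS be))).
  by apply: measurable_cat => //; exact: measurableT_comp.
by apply/funext => p; apply/funext => S; rewrite ext_mktraj //= val_tcast.
Qed.

Lemma pmeas_fun_at d (T : measurableType d) (F : T -> seq traj -> \bar R) S :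
  all valid_traj S -> pmeas_fun F -> measurable_fun setT (fun x => F x S).
Proof.
elim: S F => [|X S IH] F /=; first by move=> _ mF; exact: (mF [::]).
move=> /andP[/valid_trajP[b [e [t [be ->]]]] vS] mF.
apply: (IH (fun x S => F x (mktraj n b e t :: S))) => //.
apply: (pmeas_fun_precomp (u := fun x => (x, t)) _ (pmeas_fun_cons be mF)).
exact: measurable_fun_pair.
Qed.

End Extension.

(** * The transition kernel applied to a multi-Bernoulli set *)

Section Transition.
Context {R : realType} {n : nat}.
Notation traj := (@traj R n).
Local Open Scope ereal_scope.
Variables (k : nat) (PS : n.-tuple R -> R) (pix : n.-tuple R -> n.-tuple R -> R).
Variable bs : seq (@bcomp R n).
Hypothesis mPS : measurable_fun setT (fun x => (PS x)%:E).
Hypothesis PS01 : forall x, (0 <= PS x <= 1)%R.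
Hypothesis mpix :
  measurable_fun setT (fun yx : (n.-tuple R * n.-tuple R)%type => (pix yx.1 yx.2)%:E).
Hypothesis pix0 : forall y x, (0 <= pix y x)%R.
Hypothesis okbs : all_ok bs.

Notation tr := (trans_int k PS pix (mbexp k bs)).

Lemma PSk_ge0 X : (0 <= PSk PS k X)%R.
Proof. by rewrite /PSk; case: ifP => // _; case/andP: (PS01 (lastst X)). Qed.

Lemma PSk_le1 X : (0 <= 1 - PSk PS k X)%R.
Proof. by rewrite subr_ge0 /PSk; case: ifP => // _; case/andP: (PS01 (lastst X)). Qed.

Lemma measurable_PSk : meas_traj_fun (fun X => (PSk PS k X)%:E).
Proof.
move=> b e be; rewrite (_ : (fun _ => _) = if e == k.-1 then
  fun t : (tlen n b e).-tuple R => (PS (lastst (mktraj n b e t)))%:E else cst 0).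
  by case: eqP => // _; exact: (measurable_precomp mPS (@measurable_lastst _ _ b e)).
by apply/funext => t; rewrite /PSk (_ : te (mktraj n b e t) = e) //; case: ifP.
Qed.

Lemma measurable_1PSk : meas_traj_fun (fun X => (1 - PSk PS k X)%:E).
Proof.
move=> b e be; under eq_fun do rewrite EFinB.
by apply: emeasurable_funB => //; exact: measurable_PSk.
Qed.

Lemma measurable_pix b e : measurable_fun setT (fun p : (tlen n b e).-tuple R * n.-tuple R =>
  (pix p.2 (lastst (mktraj n b e p.1)))%:E).
Proof.
apply: (measurable_comp2 mpix) => //.
exact: (measurable_precomp (@measurable_lastst _ _ b e)).
Qed.

Lemma trans_int_ge0 L g : (forall S, 0 <= g S) -> 0 <= tr L g.
Proof.
elim: L g => [|X L IH] g g0 /=; first exact: mbexp_ge0.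
rewrite adde_ge0 // mule_ge0 ?lee_fin ?PSk_le1 ?PSk_ge0 ?IH //.
by apply: iint_ge0 => y; rewrite mule_ge0 ?lee_fin ?IH.
Qed.

Lemma eq_trans_int L g g' : all valid_traj L ->
  (forall S, all valid_traj S -> g S = g' S) -> tr L g = tr L g'.
Proof.
elim: L g g' => [|X L IH] g g' /=; first by move=> _; exact: eq_mbexp.
move=> /andP[vX vL] gg'; rewrite (IH g g') //; congr (_ + _ * _).
apply: eq_iint => y; congr (_ * _); apply: IH => // S vS.
by apply: gg'; rewrite /= valid_ext.
Qed.

Lemma pmeas_trans_int d (T : measurableType d) (F : T -> seq traj -> \bar R) :
  pmeas_fun F -> (forall x S, 0 <= F x S) -> pmeas_fun (fun x L => tr L (F x)).
Proof.
move=> mF F0 sh; elim: sh d T F mF F0 => [|[b e] sh IH] d T F mF F0 /=.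
  by move=> _; exact: measurable_mbexp.
move=> /andP[be oksh]; apply: pmeasD.
  apply: pmeasM.
    apply: (pmeas_fun_param (c := fun p : T * (tlen n b e).-tuple R =>
      (1 - PSk PS k (mktraj n b e p.2))%:E)) => //.
    exact: (measurable_precomp (measurable_1PSk be)).
  apply: (IH _ _ (fun p : T * (tlen n b e).-tuple R => F p.1)) => //.
  exact: (pmeas_fun_precomp (u := fst) _ mF).
apply: pmeasM.
  apply: (pmeas_fun_param (c := fun p : T * (tlen n b e).-tuple R =>
    (PSk PS k (mktraj n b e p.2))%:E)) => //.
  exact: (measurable_precomp (measurable_PSk be)).
apply: (@pmeas_iint _ _ _ _ _ _ (fun (p : T * (tlen n b e).-tuple R) y S =>
  (pix y (lastst (mktraj n b e p.2)))%:E *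
  tr S (fun S0 => F p.1 (ext (mktraj n b e p.2) y :: S0)))); last first.
  by move=> *; rewrite mule_ge0 ?lee_fin ?trans_int_ge0.
apply: pmeasM.
  apply: (pmeas_fun_param (c := fun p : (T * (tlen n b e).-tuple R) * n.-tuple R =>
    (pix p.2 (lastst (mktraj n b e p.1.2)))%:E)) => //.
  apply: (measurable_comp2 (@measurable_pix b e)) => //; exact: measurableT_comp.
apply: (IH _ _ (fun p : (T * (tlen n b e).-tuple R) * n.-tuple R =>
  fun S0 => F p.1.1 (ext (mktraj n b e p.1.2) p.2 :: S0))) => //.
exact: pmeas_fun_ext.
Qed.

Lemma meas_functional_trans_int L : all valid_traj L -> meas_functional (tr L).
Proof.
move=> vL d T F mF F0; apply: (@pmeas_fun_at _ _ _ _ (fun x S => tr S (F x)) _ vL).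
exact: pmeas_trans_int.
Qed.

Lemma meas_ext_cons X (g : seq traj -> \bar R) : valid_traj X -> meas_set_fun g ->
  pmeas_fun (fun y S => g (ext X y :: S)).
Proof.
move=> /valid_trajP[b [e [t [be ->]]]] /(pmeas_fun_ext be).
apply: (pmeas_fun_precomp (u := fun y => ((tt, t), y))).
exact: measurable_fun_pair.
Qed.

Lemma measurable_pix_valid X : valid_traj X ->
  measurable_fun setT (fun y => (pix y (lastst X))%:E).
Proof. by move=> _; apply: (measurable_comp2 mpix). Qed.

(** Both sides are sums over the four survival patterns of [X] and [Y]. Only the pattern where both
    survive needs an argument: Tonelli exchanges the two new states, and the symmetry of [g]
    exchanges the two extended trajectories. *)
Lemma trans_int_swap X Y L g : all valid_traj [:: X, Y & L] ->
  meas_set_fun g -> swap_sym g -> (forall S, 0 <= g S) ->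
  tr [:: X, Y & L] g = tr [:: Y, X & L] g.
Proof.
move=> /and3P[vX vY vL] mg sg g0 /=.
set p := PSk PS k X; set q := PSk PS k Y.
have t0 g' : (forall S, 0 <= g' S) -> 0 <= tr L g' by exact: trans_int_ge0.
have mt Z Z' g' : valid_traj Z -> valid_traj Z' -> meas_set_fun g' -> (forall S, 0 <= g' S) ->
    measurable_fun setT (fun y => (pix y (lastst Z'))%:E * tr L (fun S => g' (ext Z y :: S))).
  move=> vZ vZ' mg' g'0; apply: emeasurable_funM; first exact: measurable_pix_valid.
  by apply: meas_functional_trans_int => //; exact: meas_ext_cons.
have mgX Z y : valid_traj Z -> meas_set_fun (fun S => g (ext Z y :: S)).
  by move=> vZ; exact: pmeas_fun_section (meas_ext_cons vZ mg).
have m2 Z Z' : valid_traj Z -> valid_traj Z' ->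
    measurable_fun setT (fun p : n.-tuple R * n.-tuple R => (pix p.1 (lastst Z))%:E *
      ((pix p.2 (lastst Z'))%:E * tr L (fun S => g (ext Z p.1 :: ext Z' p.2 :: S)))).
  move=> vZ vZ'; apply: emeasurable_funM.
    exact: (measurable_precomp (measurable_pix_valid vZ)).
  apply: emeasurable_funM; first exact: (measurable_precomp (measurable_pix_valid vZ')).
  apply: meas_functional_trans_int => //.
  move: vZ' => /valid_trajP[b [e [t [be ->]]]].
  have := pmeas_fun_ext be (meas_ext_cons vZ mg).
  apply: (pmeas_fun_precomp (u := fun p => ((p.1, t), p.2))).
  by apply: measurable_fun_pair => //; exact: measurable_fun_pair.
(* The case where [Z] survives, split by the fate of [Z'], with the survival factors outside and the
   term of double survival in the form of a double integral. *)
have key Z Z' : valid_traj Z -> valid_traj Z' ->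
    iint n (fun y => (pix y (lastst Z))%:E * ((1 - PSk PS k Z')%:E * tr L (fun S => g (ext Z y :: S))
      + (PSk PS k Z')%:E * iint n (fun y' => (pix y' (lastst Z'))%:E *
          tr L (fun S => g (ext Z y :: ext Z' y' :: S))))) =
    (1 - PSk PS k Z')%:E * iint n (fun y => (pix y (lastst Z))%:E * tr L (fun S => g (ext Z y :: S)))
    + (PSk PS k Z')%:E * iint n (fun y => iint n (fun y' => (pix y (lastst Z))%:E *
        ((pix y' (lastst Z'))%:E * tr L (fun S => g (ext Z y :: ext Z' y' :: S))))).
  move=> vZ vZ'.
  have i0 y : 0 <= iint n (fun y' => (pix y (lastst Z))%:E * ((pix y' (lastst Z'))%:E *
          tr L (fun S => g (ext Z y :: ext Z' y' :: S)))).
    by apply: iint_ge0 => y'; rewrite !mule_ge0 ?lee_fin ?t0.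
  have mi : measurable_fun setT (fun y => iint n (fun y' => (pix y (lastst Z))%:E *
      ((pix y' (lastst Z'))%:E * tr L (fun S => g (ext Z y :: ext Z' y' :: S))))).
    apply: (@measurable_iint _ _ _ _ (fun y y' => (pix y (lastst Z))%:E *
      ((pix y' (lastst Z'))%:E * tr L (fun S => g (ext Z y :: ext Z' y' :: S)))) (m2 _ _ vZ vZ')) => y y'.
    by rewrite !mule_ge0 ?lee_fin ?t0.
  rewrite -!iintZ ?lee_fin ?PSk_le1 ?PSk_ge0 //; first last.
  - by move=> y; rewrite mule_ge0 ?lee_fin ?t0.
  - exact: mt.
  rewrite -iintD; first last.
  - by move=> y; rewrite mule_ge0 ?lee_fin ?PSk_ge0.
  - exact: emeasurable_funM.
  - by move=> y; rewrite !mule_ge0 ?lee_fin ?PSk_le1 ?t0.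
  - by apply: emeasurable_funM => //; exact: mt.
  apply: eq_iint => y; rewrite ge0_muleDr; last 2 first.
  - by rewrite mule_ge0 ?lee_fin ?PSk_le1 ?t0.
  - by rewrite mule_ge0 ?lee_fin ?PSk_ge0 ?iint_ge0 // => y'; rewrite mule_ge0 ?lee_fin ?t0.
  congr (_ + _); first by rewrite muleCA.
  rewrite muleCA; congr (_ * _); rewrite -iintZ ?lee_fin // => [|y'].
    2: by rewrite mule_ge0 ?lee_fin ?t0.
  exact: (mt _ _ (fun S => g (ext Z y :: S)) vZ' vZ' (mgX _ _ vZ)).
rewrite (key X Y) // (key Y X) // -/p -/q.
have pE : 0 <= p%:E by rewrite lee_fin PSk_ge0.
have qE : 0 <= q%:E by rewrite lee_fin PSk_ge0.
have p1E : 0 <= (1 - p)%:E by rewrite lee_fin PSk_le1.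
have q1E : 0 <= (1 - q)%:E by rewrite lee_fin PSk_le1.
have I0 Z : 0 <= iint n (fun y => (pix y (lastst Z))%:E * tr L (fun S => g (ext Z y :: S))).
  by apply: iint_ge0 => y; rewrite mule_ge0 ?lee_fin ?t0.
have J0 Z Z' : 0 <= iint n (fun y => iint n (fun y' => (pix y (lastst Z))%:E *
        ((pix y' (lastst Z'))%:E * tr L (fun S => g (ext Z y :: ext Z' y' :: S))))).
  by apply: iint_ge0 => y; apply: iint_ge0 => y'; rewrite !mule_ge0 ?lee_fin ?t0.
rewrite !ge0_muleDr ?mule_ge0 ?t0 //.
have -> : iint n (fun y => iint n (fun y' => (pix y (lastst Y))%:E *
        ((pix y' (lastst X))%:E * tr L (fun S => g (ext Y y :: ext X y' :: S))))) =
   iint n (fun y => iint n (fun y' => (pix y (lastst X))%:E *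
        ((pix y' (lastst Y))%:E * tr L (fun S => g (ext X y :: ext Y y' :: S))))).
  rewrite (iint_swap (m2 _ _ vY vX)) => [|y y']; last by rewrite !mule_ge0 ?lee_fin ?t0.
  apply: eq_iint => y; apply: eq_iint => y'; rewrite muleCA; congr (_ * (_ * _)).
  apply: eq_trans_int => // S vS.
  by apply: (sg [::]); rewrite /= !valid_ext.
(* The two patterns with exactly one survivor change places. *)
by rewrite addeACA; congr (_ + _ + (_ + _)); rewrite muleCA.
Qed.

Lemma swap_sym_trans_int g : meas_set_fun g -> swap_sym g -> (forall S, 0 <= g S) ->
  swap_sym (fun L => tr L g).
Proof.
move=> + + + P X Y S; elim: P g => [|Z P IH] g mg sg g0; first by move=> v; exact: trans_int_swap.
move=> /= /andP[vZ vP]; rewrite IH //; congr (_ + _ * _); apply: eq_iint => y.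
congr (_ * _); apply: IH => //; last by apply: swap_sym_cons => //; exact: valid_ext.
exact: pmeas_fun_section (meas_ext_cons vZ mg).
Qed.

(** Keeps the old and the predicted density of a component together, so that a single induction runs
    over the components before and after prediction. *)
Record pred_comp := PredComp { pc_ex : R; pc_den : traj -> R; pc_pden : traj -> R }.

Definition pred_comp_ok (c : pred_comp) :=
  [/\ bcomp_ok (pc_ex c, pc_den c), (forall X, 0 <= pc_pden c X)%R,
      traj_meas (fun X => (pc_pden c X)%:E),
      trajint k.-1 (fun X => (pc_den c X)%:E) = 1
    & is_pred_density k PS pix (pc_den c) (pc_pden c)].

Fixpoint all_pred_ok (cs : seq pred_comp) : Prop :=
  if cs is c :: cs' then pred_comp_ok c /\ all_pred_ok cs' else True.

Definition old_comp (c : pred_comp) : @bcomp R n := (pc_ex c, pc_den c).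
Definition new_comp (c : pred_comp) : @bcomp R n :=
  (pc_ex c * fine (ipS k PS (pc_den c)), pc_pden c)%R.

Lemma all_pred_ok_map (I : Type) (s : seq I) (h : I -> pred_comp) :
  (forall i, pred_comp_ok (h i)) -> all_pred_ok [seq h i | i <- s].
Proof. by move=> okh; elim: s => [|i s IH]. Qed.

Lemma all_ok_old cs : all_pred_ok cs -> all_ok (map old_comp cs).
Proof. by elim: cs => [|c cs IH] //= [[okc _ _ _ _] okcs]; split=> //; exact: IH. Qed.

(** The unit mass of [f] splits into a surviving and a dying part, both nonnegative with sum 1. In
    particular [ipS] is finite, so the [fine] in the new existence probability loses nothing. *)
Lemma ipS_compl f : (forall X, 0 <= f X)%R -> meas_traj_fun (fun X => (f X)%:E) ->
  trajint k.-1 (fun X => (f X)%:E) = 1 ->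
  exists s : R, [/\ (0 <= s <= 1)%R, ipS k PS f = s%:E &
    trajint k.-1 (fun X => (f X * (1 - PSk PS k X))%:E) = (1 - s)%:E].
Proof.
move=> f0 mf f1.
pose a := ipS k PS f; pose b := trajint k.-1 (fun X => (f X * (1 - PSk PS k X))%:E).
have a0 : 0 <= a by apply: trajint_ge0 => X; rewrite lee_fin mulr_ge0 ?PSk_ge0.
have b0 : 0 <= b by apply: trajint_ge0 => X; rewrite lee_fin mulr_ge0 ?PSk_le1.
have : a + b = 1.
  rewrite -f1 /a /b /ipS -trajintD.
  - by apply: eq_trajint => *; rewrite -EFinD -mulrDr subrKC mulr1.
  - move=> b' e be; under eq_fun do rewrite EFinM.
    by apply: emeasurable_funM; [exact: mf | exact: measurable_PSk].
  - by move=> X; rewrite lee_fin mulr_ge0 ?PSk_ge0.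
  - move=> b' e be; under eq_fun do rewrite EFinM.
    by apply: emeasurable_funM; [exact: mf | exact: measurable_1PSk].
  - by move=> X; rewrite lee_fin mulr_ge0 ?PSk_le1.
rewrite -/a -/b; case: a a0 => [s| |] //; case: b b0 => [u| |] //.
rewrite !lee_fin => u0 s0 [su]; exists s; split=> //; last by rewrite -su addrAC subrr add0r.
by rewrite s0 -su lerDl.
Qed.

Lemma all_ok_new cs : all_pred_ok cs -> all_ok (map new_comp cs).
Proof.
elim: cs => [|c cs IH] //= [[[/= /andP[r0 r1] f0 mf] fp0 mfp f1 _] okcs]; split; last exact: IH.
have [s [/andP[s0 s1] sE _]] := ipS_compl f0 mf f1.
rewrite /new_comp sE; split=> //=.
by rewrite mulr_ge0 //= mulr_ile1.
Qed.

Lemma all_ok_cat (cs cs' : seq (@bcomp R n)) : all_ok cs -> all_ok cs' -> all_ok (cs ++ cs').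
Proof. by elim: cs => [|c cs IH] //= [okc okcs] okcs'; split=> //; exact: IH. Qed.

(** The defining relation of [fp] with the normalising constant multiplied out; in this form it also
    covers [<f; P^S> = 0]. *)
Lemma trajint_pic_int f fp (h : traj -> \bar R) :
  (forall X, 0 <= f X)%R -> meas_traj_fun (fun X => (f X)%:E) ->
  trajint k.-1 (fun X => (f X)%:E) = 1 -> is_pred_density k PS pix f fp ->
  meas_traj_fun h -> (forall X, 0 <= h X) -> meas_traj_fun (pic_int pix h) ->
  trajint k.-1 (fun X => (PSk PS k X * f X)%:E * pic_int pix h X) =
  ipS k PS f * trajint k (fun X => (fp X)%:E * h X).
Proof.
move=> f0 mf f1 fpP mh h0 mpic.
have pic0 X : 0 <= pic_int pix h X by apply: iint_ge0 => y; rewrite mule_ge0 ?lee_fin.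
have mPf : meas_traj_fun (fun X => (PSk PS k X * f X)%:E).
  move=> b e be; under eq_fun do rewrite EFinM.
  by apply: emeasurable_funM; [exact: measurable_PSk | exact: mf].
have Pf0 X : (0 <= PSk PS k X * f X)%R by rewrite mulr_ge0 ?PSk_ge0.
have [s [/andP[s0 s1] sE _]] := ipS_compl f0 mf f1.
rewrite sE; have [s00|sN0] := eqVneq s 0%R.
  (* here [is_pred_density] reads [+oo * _] and carries no information; instead
     PS f = 0 almost everywhere, expressed by [\int +oo * (PS f) = 0] *)
  rewrite s00 mul0e.
  have ooPf0 : trajint k.-1 (fun X => +oo * (PSk PS k X * f X)%:E) = 0.
    rewrite trajintZ // (_ : trajint _ _ = 0) ?mule0 //; transitivity (ipS k PS f).
      by apply: eq_trajint => *; rewrite mulrC.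
    by rewrite sE s00.
  (* Adding the zero integral of [+oo * (PS f)] changes nothing; pointwise this term absorbs the
     integrand where [PS f > 0], and elsewhere both are 0. *)
  rewrite -[RHS]ooPf0 -[LHS]adde0 -[X in _ + X]ooPf0 -trajintD.
  - apply: eq_trajint => b e t be; set X := mktraj _ _ _ _.
    have [->|Pf] := eqVneq (PSk PS k X * f X)%R 0%R; first by rewrite mul0e mule0 adde0.
    rewrite gt0_mulye ?lte_fin ?lt0r ?Pf ?Pf0 // addey // -ltNye.
    by rewrite (lt_le_trans (ltNyr 0%R)) // mule_ge0 // lee_fin.
  - by move=> b e be; apply: emeasurable_funM; [exact: mPf | exact: mpic].
  - by move=> X; rewrite mule_ge0 ?lee_fin.
  - by move=> b e be; apply: emeasurable_funM => //; exact: mPf.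
  - by move=> X; rewrite mule_ge0 ?lee_fin.
(* [is_pred_density] asks for test functions measurable at all pairs [b], [e], while [h] is
   controlled only for [b <= e]. The cut-off is not seen by the integrals. *)
pose h' X := if (tb X <= te X)%N then h X else 0.
have h'0 X : 0 <= h' X by rewrite /h'; case: ifP.
have mh' : traj_meas h'.
  move=> b e; rewrite /h' /tb /te /=; case: (boolP (b <= e)%N) => be; last exact: measurable_cst.
  exact: mh.
have hh' b e t : (b <= e)%N -> h' (mktraj n b e t) = h (mktraj n b e t).
  by move=> be; rewrite /h' /= be.
rewrite (_ : trajint k _ = trajint k (fun X => h' X * (fp X)%:E)); last first.
  by apply: eq_trajint => b e t be; rewrite muleC hh'.
rewrite fpP // sE inver (negPf sN0) muleA -EFinM divff // mul1e.
apply: eq_trajint => b e t be; congr (_ * _); apply: eq_iint => y; congr (_ * _).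
by rewrite ext_mktraj // hh' // leqW.
Qed.

(** The test function varies in the induction: once the head component survives as [ext X y], the
    remaining components are integrated against [g (ext X y :: _)]. *)
Lemma mbexp_trans_int cs (g : seq traj -> \bar R) : all_pred_ok cs ->
  meas_set_fun g -> swap_sym g -> (forall S, 0 <= g S) ->
  mbexp k.-1 (map old_comp cs) (fun L => tr L g) = mbexp k (map new_comp cs ++ bs) g.
Proof.
elim: cs g => [|[r f fp] cs IH] g //= [[[/= /andP[r0 r1] f0 mf] fp0 mfp f1 fpP] okcs] mg sg g0.
have okn : all_ok (map new_comp cs ++ bs).
  by apply: all_ok_cat => //; exact: all_ok_new.
have oko := all_ok_old okcs.
pose Q g' := mbexp k (map new_comp cs ++ bs) g'.
(* Conditional expectation of [g] when the head component is the predicted trajectory [X]; this is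
   the test function handed to [trajint_pic_int]. *)
pose h X := Q (fun S => g (X :: S)).
have Q0 g' : (forall S, 0 <= g' S) -> 0 <= Q g' by exact: mbexp_ge0.
have mh : meas_traj_fun h.
  by apply: meas_functional_cons => //; exact: measurable_mbexp.
have h0 X : 0 <= h X by exact: Q0.
have pic0 X : 0 <= pic_int pix h X by apply: iint_ge0 => y; rewrite mule_ge0 ?lee_fin.
have mpic : meas_traj_fun (pic_int pix h).
  move=> b e be; apply: (@measurable_iint _ _ _ _ (fun (t : (tlen n b e).-tuple R) y =>
    (pix y (lastst (mktraj n b e t)))%:E * h (ext (mktraj n b e t) y))); last first.
    by move=> *; rewrite mule_ge0 ?lee_fin.
  apply: emeasurable_funM; first exact: measurable_pix.
  apply: measurable_mbexp => //; have := pmeas_fun_ext be mg.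
  apply: (pmeas_fun_precomp (u := fun p => ((tt, p.1), p.2))).
  by apply: measurable_fun_pair => //; exact: measurable_fun_pair.
have [s [/andP[s0 s1] sE s1E]] := ipS_compl f0 mf f1.
have step X : valid_traj X -> mbexp k.-1 (map old_comp cs) (fun L => tr (X :: L) g) =
    (1 - PSk PS k X)%:E * Q g + (PSk PS k X)%:E * pic_int pix h X.
  move=> vX /=; have mX := meas_ext_cons vX mg.
  have mtr : meas_set_fun (fun L => tr L g) by exact: pmeas_trans_int.
  have mtrX : pmeas_fun (fun y L => (pix y (lastst X))%:E * tr L (fun S => g (ext X y :: S))).
    apply: pmeas_funM; last exact: pmeas_trans_int.
    exact: (pmeas_fun_param (measurable_pix_valid vX)).
  have trX0 y L : 0 <= (pix y (lastst X))%:E * tr L (fun S => g (ext X y :: S)).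
    by rewrite mule_ge0 ?lee_fin ?trans_int_ge0.
  have mi : meas_set_fun (fun L => iint n (fun y =>
      (pix y (lastst X))%:E * tr L (fun S => g (ext X y :: S)))).
    move=> sh oksh; apply: (@pmeas_iint _ _ _ _ _ unit (fun _ y L =>
      (pix y (lastst X))%:E * tr L (fun S => g (ext X y :: S)))) => //.
    exact: (pmeas_fun_precomp (u := snd) _ mtrX).
  rewrite mbexpD //; first last.
  - by move=> L; rewrite mule_ge0 ?lee_fin ?PSk_ge0 ?iint_ge0.
  - by apply: pmeas_funM => //; exact: pmeas_fun_param.
  - by move=> L; rewrite mule_ge0 ?lee_fin ?PSk_le1 ?trans_int_ge0.
  - by apply: pmeas_funM => //; exact: pmeas_fun_param.
  rewrite !mbexpZ ?lee_fin ?PSk_ge0 ?PSk_le1 //; first last.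
  - by move=> L; exact: trans_int_ge0.
  - by move=> L; exact: iint_ge0.
  rewrite IH //; congr (_ + _ * _); rewrite mbexp_iint //; apply: eq_iint => y.
  rewrite mbexpZ ?lee_fin //; first last.
  - by move=> L; exact: trans_int_ge0.
  - apply: (pmeas_trans_int (F := fun _ : unit => _)) => //; exact: pmeas_fun_section mX.
  congr (_ * _); apply: IH => //; first exact: pmeas_fun_section mX.
  by apply: swap_sym_cons => //; exact: valid_ext.
rewrite IH // -/(Q g) sE /=.
transitivity ((1 - r)%:E * Q g + r%:E * (Q g * (1 - s)%:E +
    s%:E * trajint k (fun X => (fp X)%:E * h X))); last first.
  have fph0 : 0 <= trajint k (fun X => (fp X)%:E * h X).
    by apply: trajint_ge0 => X; rewrite mule_ge0 ?lee_fin.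
  rewrite ge0_muleDr; [|by rewrite mule_ge0 ?lee_fin ?subr_ge0 ?Q0..].
  rewrite addeA [Q g * _]muleC !muleA -!EFinM -ge0_muleDl ?lee_fin ?subr_ge0 ?mulr_ge0 ?subr_ge0 //.
  by rewrite -EFinD mulrBr mulr1 addrA subrK.
congr (_ + _ * _); rewrite -sE -trajint_pic_int // -s1E -trajintZ ?Q0 //; first last.
- by move=> X; rewrite lee_fin mulr_ge0 ?PSk_le1.
- move=> b e be; under eq_fun do rewrite EFinM.
  by apply: emeasurable_funM; [exact: mf | exact: measurable_1PSk].
rewrite -trajintD; first last.
- by move=> X; rewrite mule_ge0 ?lee_fin ?mulr_ge0 ?PSk_ge0.
- move=> b e be; apply: emeasurable_funM; last exact: mpic.
  under eq_fun do rewrite EFinM.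
  by apply: emeasurable_funM; [exact: measurable_PSk | exact: mf].
- by move=> X; rewrite mule_ge0 ?lee_fin ?mulr_ge0 ?PSk_le1 ?Q0.
- move=> b e be; apply: emeasurable_funM => //.
  under eq_fun do rewrite EFinM.
  by apply: emeasurable_funM; [exact: mf | exact: measurable_1PSk].
apply: eq_trajint => b e t be; have vX := valid_mktraj t be.
rewrite step // ge0_muleDr; [|by rewrite mule_ge0 ?lee_fin ?PSk_le1 ?PSk_ge0 ?Q0..].
by rewrite [Q g * _]muleC !muleA -!EFinM [(f _ * PSk _ _ _)%R]mulrC.
Qed.

End Transition.

(** * From labelled decompositions to the recursion over components *)

Section LabelledDecomposition.
Context {R : realType} {n : nat}.
Notation traj := (@traj R n).

(** [mb_dens] is by definition the case of Bernoulli factors. Arbitrary factors are allowed because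
    a component that has already received an element is no longer Bernoulli. *)
Definition conv N (F : 'I_N -> seq traj -> R) (S : seq traj) : R :=
  \sum_(sig : {ffun 'I_(size S) -> 'I_N})
    \prod_(i < N) F i
        [seq nth (0%N, 0%N, [::]) S (nat_of_ord j) | j <- enum 'I_(size S) & sig j == i].

Lemma eq_conv N (F G : 'I_N -> seq traj -> R) S : (forall i, F i =1 G i) -> conv F S = conv G S.
Proof. by move=> FG; apply: eq_bigr => sig _; apply: eq_bigr => i _; exact: FG. Qed.

Lemma conv_nil N (F : 'I_N -> seq traj -> R) : conv F [::] = \prod_(i < N) F i [::].
Proof.
rewrite /conv (big_pred1 (ffun0 (card_ord 0))) => [|sig].
  by apply: eq_bigr => i _; rewrite (_ : enum 'I_0 = [::]) //; apply/size0nil; rewrite size_enum_ord.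
by apply/esym/eqP/ffunP; case.
Qed.

Definition prepend_at N (F : 'I_N -> seq traj -> R) (i0 : 'I_N) X (i : 'I_N) (S : seq traj) : R :=
  if i == i0 then F i (X :: S) else F i S.

Lemma conv_cons N (F : 'I_N -> seq traj -> R) X S :
  conv F (X :: S) = \sum_(i0 < N) conv (prepend_at F i0 X) S.
Proof.
rewrite /conv pair_bigA /=.
pose h (p : 'I_N * {ffun 'I_(size S) -> 'I_N}) : {ffun 'I_(size S).+1 -> 'I_N} :=
  [ffun j => if unlift ord0 j is Some j' then p.2 j' else p.1].
rewrite (reindex h) /=; last first.
  exists (fun sig => (sig ord0, [ffun j => sig (lift ord0 j)])) => [[i0 sig] _|sig _] /=.
    rewrite /h ffunE unlift_none; congr pair; apply/ffunP => j.
    by rewrite !ffunE liftK.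
  by apply/ffunP => j; rewrite ffunE; case: unliftP => [j'|] -> /=; rewrite ?ffunE.
apply: eq_bigr => -[i0 sig] _ /=; apply: eq_bigr => i _.
rewrite enum_ordSl /= /h ffunE unlift_none /= filter_map.
have -> : [seq x <- enum 'I_(size S) | preim (lift ord0)
    (fun j => [ffun j0 => if unlift ord0 j0 is Some j' then sig j' else i0] j == i) x] =
    [seq x <- enum 'I_(size S) | sig x == i].
  by apply: eq_filter => j /=; rewrite ffunE liftK.
rewrite /prepend_at [i == i0]eq_sym; case: eqP => [_|_] /=.
  by rewrite -map_comp; congr (F i (_ :: _)); apply: eq_map => j.
by rewrite -map_comp; congr (F i _); apply: eq_map => j.
Qed.

(** A component that accepts no element must be empty in every nonzero term. It is applied to a
    Bernoulli component that already holds its one element. *)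
Lemma conv_recl0 N (F : 'I_N.+1 -> seq traj -> R) S :
  (forall X S', F ord0 (X :: S') = 0) ->
  conv F S = F ord0 [::] * conv (fun i => F (lift ord0 i)) S.
Proof.
elim: S F => [|X S IH] F F0; first by rewrite !conv_nil big_ord_recl.
rewrite !conv_cons big_ord_recl IH => [|Y S']; last by rewrite /prepend_at eqxx F0.
rewrite {1}/prepend_at eqxx F0 mul0r add0r mulr_sumr; apply: eq_bigr => i _.
rewrite IH => [|Y S']; last by rewrite /prepend_at eq_liftF F0.
by rewrite {1}/prepend_at eq_liftF; congr (_ * _).
Qed.

Local Open Scope ereal_scope.

Lemma pick_sum_sum (I : Type) (s : seq I) (H : I -> traj -> seq traj -> \bar R) S :
  \sum_(i <- s) pick_sum (H i) S = pick_sum (fun X S' => \sum_(i <- s) H i X S') S.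
Proof.
elim: S H => [|X S IH] H /=; first by rewrite big1.
by rewrite big_split /= IH.
Qed.

(** Induction over the elements yields the recursion over components: the head of [S] either goes to
    component [ord0], which is then full, or to another component, whose modified factor the
    induction hypothesis admits. *)
Lemma conv_recl_bern N r f (F : 'I_N.+1 -> seq traj -> R) S : F ord0 =1 bern r f ->
  (conv F S)%:E = (1 - r)%:E * (conv (fun i => F (lift ord0 i)) S)%:E +
    pick_sum (fun X S' => (r * f X)%:E * (conv (fun i => F (lift ord0 i)) S')%:E) S.
Proof.
elim: S F => [|X S IH] F F0.
  by rewrite /= adde0 !conv_nil big_ord_recl F0 EFinM.
rewrite !conv_cons big_ord_recl conv_recl0 => [|Y S']; last first.
  by rewrite /prepend_at eqxx F0.
rewrite {1}/prepend_at eqxx F0 /= [in RHS]addeCA EFinD EFinM; congr (_ * _ + _).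
have prep i : conv (fun j => prepend_at F (lift ord0 i) X (lift ord0 j)) =1
    conv (prepend_at (fun j => F (lift ord0 j)) i X).
  by move=> S'; apply: eq_conv => j S''; rewrite /prepend_at (inj_eq (@lift_inj _ ord0)).
pose Fl i S' := F (lift ord0 i) S'.
rewrite -[LHS]sumEFin (eq_bigr (fun i => (1 - r)%:E * (conv (prepend_at Fl i X) S)%:E +
    pick_sum (fun Y S' => (r * f Y)%:E * (conv (prepend_at Fl i X) S')%:E) S)); last first.
  move=> i _; rewrite (IH (prepend_at F (lift ord0 i) X)) => [|S'].
    by rewrite prep; congr (_ + pick_sum _ _).
  by rewrite /prepend_at eq_liftF F0.
rewrite big_split /= pick_sum_sum; congr (_ + _).
  under eq_bigr do rewrite -EFinM.
  by rewrite sumEFin -mulr_sumr EFinM.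
congr pick_sum; apply/funext => Y; apply/funext => S'.
under eq_bigr do rewrite -EFinM.
by rewrite sumEFin -mulr_sumr EFinM conv_cons.
Qed.

Lemma mb_dens_mbl N (r : 'I_N -> R) (f : 'I_N -> traj -> R) S :
  (mb_dens r f S)%:E = mbl [seq (r i, f i) | i <- enum 'I_N] S.
Proof.
suff: (conv (fun i => bern (r i) (f i)) S)%:E = mbl [seq (r i, f i) | i <- enum 'I_N] S by [].
elim: N r f S => [|N IH] r f S.
  have -> : [seq (r i, f i) | i <- enum 'I_0] = [::].
    by apply/size0nil; rewrite size_map size_enum_ord.
  by case: S => [|X S]; rewrite ?conv_nil ?conv_cons big_ord0.
rewrite (@conv_recl_bern _ (r ord0) (f ord0)) // enum_ordSl /= -map_comp.
rewrite (IH (fun i => r (lift ord0 i)) (fun i => f (lift ord0 i))); congr (_ + pick_sum _ _).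
apply/funext => X; apply/funext => S'.
by rewrite (IH (fun i => r (lift ord0 i)) (fun i => f (lift ord0 i))).
Qed.

End LabelledDecomposition.

(** * Birth process and mixtures of multi-Bernoulli densities *)

Section Birth.
Context {R : realType} {n : nat}.
Notation traj := (@traj R n).
Local Open Scope ereal_scope.

Lemma all_ok_map (I : Type) (s : seq I) (h : I -> @bcomp R n) :
  (forall i, bcomp_ok (h i)) -> all_ok [seq h i | i <- s].
Proof. by move=> okh; elim: s => [|i s IH]. Qed.

Lemma all_valid_decode sh (t : seq R) : all (fun q => q.1 <= q.2)%N sh ->
  all valid_traj (Defs.decode n sh t).
Proof.
elim: sh t => [|[b e] sh IH] t //= /andP[be oksh].
by rewrite valid_mktraj // IH.
Qed.

Lemma eq_setint K (F G : seq traj -> \bar R) :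
  (forall S, all valid_traj S -> F S = G S) -> setint K F = setint K G.
Proof.
move=> FG; apply: eq_eseriesr => m _; congr (_ * _); apply: eq_bigr => sh oksh.
apply: eq_iint => t; apply: FG; apply: all_valid_decode.
by rewrite /shape_of all_map.
Qed.

Lemma bcomp_ok_fB k r (f : n.-tuple R -> R) : (0 <= r <= 1)%R -> (forall x, 0 <= f x)%R ->
  measurable_fun setT (fun x => (f x)%:E) -> bcomp_ok (r, fB k f).
Proof.
move=> r01 f0 mf; split => //= [X|b e be]; first by rewrite /fB; case: ifP.
rewrite (_ : (fun _ => _) = if (b == k) && (e == k) then
  fun t : (tlen n b e).-tuple R => (f (lastst (mktraj n b e t)))%:E else cst 0).
  by case: ifP => // _; exact: (measurable_precomp mf (@measurable_lastst _ _ b e)).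
apply/funext => t; rewrite /fB (_ : tb (mktraj n b e t) = b) // (_ : te (mktraj n b e t) = e) //.
by case: ifP.
Qed.

Lemma birth_intE k nb (rb : nat -> R) (fb : nat -> n.-tuple R -> R) (g : seq traj -> \bar R) :
  let bs := [seq (rb (nat_of_ord l), fB k (fb l)) | l <- enum 'I_nb] in
  all_ok bs -> meas_set_fun g -> swap_sym g -> (forall S, 0 <= g S) ->
  birth_int k nb rb fb g = mbexp k bs g.
Proof.
move=> bs okbs mg sg g0; rewrite -setint_mbl //.
by apply: eq_setint => S _; rewrite mb_dens_mbl.
Qed.

(** [birth_int] is known to equal [mbexp] only on measurable symmetric nonnegative functions. Fixing
    an extended trajectory as head preserves these properties, so the replacement is valid inside
    the transition. *)
Lemma eq_trans_int_good k PS pix (B B' : (seq traj -> \bar R) -> \bar R) L g :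
  (forall g, meas_set_fun g -> swap_sym g -> (forall S, 0 <= g S) -> B g = B' g) ->
  all valid_traj L -> meas_set_fun g -> swap_sym g -> (forall S, 0 <= g S) ->
  trans_int k PS pix B L g = trans_int k PS pix B' L g.
Proof.
move=> BB'; elim: L g => [|X L IH] g /=; first by move=> _; exact: BB'.
move=> /andP[vX vL] mg sg g0; rewrite IH //; congr (_ + _ * _).
apply: eq_iint => y; congr (_ * _); apply: IH => //.
  exact: pmeas_fun_section (meas_ext_cons vX mg).
by apply: swap_sym_cons => //; exact: valid_ext.
Qed.

Lemma setint_mixture K (I : finType) (P : pred I) (w : I -> R) (dens : I -> seq traj -> R)
    (cs : I -> seq (@bcomp R n)) (G : seq traj -> \bar R) :
  (forall i, P i -> 0 <= w i)%R -> (forall i, P i -> all_ok (cs i)) ->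
  (forall i S, P i -> (dens i S)%:E = mbl (cs i) S) ->
  meas_set_fun G -> swap_sym G -> (forall S, 0 <= G S) ->
  setint K (fun S => G S * (\sum_(i | P i) w i * dens i S)%R%:E) =
  \sum_(i | P i) (w i)%:E * mbexp K (cs i) G.
Proof.
move=> w0 okcs densE mG sG G0.
have Gm0 i S : P i -> 0 <= G S * mbl (cs i) S.
  by move=> Pi; rewrite mule_ge0 // mbl_ge0 //; exact: okcs.
have mGm i : P i -> meas_set_fun (fun S => G S * mbl (cs i) S).
  by move=> Pi; apply: pmeas_funM => //; apply: measurable_mbl; exact: okcs.
transitivity (setint K (fun S => \sum_(i | P i) (w i)%:E * (G S * mbl (cs i) S))).
  apply: eq_setint => S _; rewrite -sumEFin ge0_sume_distrr => [|i Pi].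
    by apply: eq_bigr => i Pi; rewrite EFinM densE // muleCA.
  by rewrite EFinM densE // mule_ge0 ?lee_fin ?w0 // mbl_ge0 //; exact: okcs.
rewrite setint_sum => [|i Pi|i S Pi].
- apply: eq_bigr => i Pi; rewrite setintZ ?w0 //; [|exact: mGm|by move=> S; exact: Gm0].
  by rewrite setint_mbl //; exact: okcs.
- by apply: pmeas_funM; [exact: pmeas_fun_param | exact: mGm].
- by rewrite mule_ge0 ?lee_fin ?w0 ?Gm0.
Qed.

End Birth.

(** * Global hypotheses before and after prediction *)

Section GlobalHypotheses.
Context {R : realType} {n : nat}.
Variables (k : nat) (PS : n.-tuple R -> R) (M : @mbm R n) (Meas : seq (nat * nat)).
Variables (nb : nat) (rb : nat -> R) (fb : nat -> n.-tuple R -> R).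
Variable fp : nat -> nat -> @traj R n -> R.
Let M' := pred_mbm k PS M nb rb fb fp.

Lemma ltn_addF m l : (m + l < m)%N = false.
Proof. by rewrite ltnNge leq_addr. Qed.

(** A new track has a single hypothesis, which forces the value 0 (hypotheses are numbered from 0),
    and its empty history meets the disjointness and inclusion conditions trivially. *)
Lemma gh_valid_pred (a : 'I_(nt M') -> nat) :
  gh_valid M' Meas a = gh_valid M Meas (fun i => a (lshift nb i)) &&
    [forall l : 'I_nb, a (rshift (nt M) l) == 0%N].
Proof.
apply/idP/idP.
  move=> /andP[/andP[/forallP h1 /forallP h2] /forallP h3]; apply/andP; split.
    apply/andP; split; first (apply/andP; split).
    - by apply/forallP => i; have := h1 (lshift nb i); rewrite /= ltn_ord.
    - apply/forallP => i; apply/forallP => j; have /forallP/(_ (lshift nb j)) := h2 (lshift nb i).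
      by rewrite (inj_eq (@lshift_inj _ _)) /= !ltn_ord.
    - by apply/forallP => i; have := h3 (lshift nb i); rewrite /= ltn_ord.
  by apply/forallP => l; have := h1 (rshift (nt M) l); rewrite /= ltn_addF /= ltnS leqn0.
move=> /andP[/andP[/andP[/forallP h1 /forallP h2] /forallP h3] /forallP h4].
apply/andP; split; first (apply/andP; split).
- apply/forallP => i; case: (split_ordP i) => j -> /=; first by rewrite ltn_ord.
  by rewrite ltn_addF /= (eqP (h4 j)).
- apply/forallP => i; apply/forallP => j; case: (split_ordP i) => i' -> /=; last first.
    by rewrite ltn_addF /= implybT.
  rewrite ltn_ord; case: (split_ordP j) => j' -> /=.
    rewrite (inj_eq (@lshift_inj _ _)).
    by have /forallP/(_ j') := h2 i'.
  by rewrite all_predT implybT.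
- apply/forallP => i; case: (split_ordP i) => j -> /=; first by rewrite ltn_ord.
  by rewrite ltn_addF.
Qed.

Lemma gh_weight_pred (a : 'I_(nt M') -> nat) :
  gh_weight M' a = gh_weight M (fun i => a (lshift nb i)).
Proof.
rewrite /gh_weight /= big_split_ord /= [X in _ * X]big1 => [|l _].
  by rewrite mulr1; apply: eq_bigr => i _; rewrite ltn_ord.
by rewrite ltn_addF.
Qed.

Lemma nh_le_hmax (i : 'I_(nt M)) : (nh M i <= hmax M)%N.
Proof. exact: leq_bigmax. Qed.

Lemma hmax_le_pred : (hmax M <= hmax M')%N.
Proof.
apply/bigmax_leqP => i _; rewrite /hmax /=.
by have := leq_bigmax (F := fun i : 'I_(nt M + nb) => if (i < nt M)%N then nh M i else 1%N)
  (lshift nb i); rewrite /= ltn_ord.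
Qed.

Lemma hmax_pred_gt0 (l : 'I_nb) : (0 < hmax M')%N.
Proof.
by have := leq_bigmax (F := fun i : 'I_(nt M + nb) => if (i < nt M)%N then nh M i else 1%N)
  (rshift (nt M) l); rewrite /= ltn_addF.
Qed.

(** The bound [hmax] is a maximum over all tracks and may grow when tracks are added, so the old
    values are widened to the new ordinal type. *)
Definition extend_gh (a : {ffun 'I_(nt M) -> 'I_(hmax M)}) : {ffun 'I_(nt M') -> 'I_(hmax M')} :=
  [ffun i : 'I_(nt M + nb) => match fintype.split i with
    | inl j => widen_ord hmax_le_pred (a j)
    | inr l => Ordinal (hmax_pred_gt0 l)
    end].

Lemma extend_gh_lshift a (i : 'I_(nt M)) : extend_gh a (lshift nb i) = a i :> nat.
Proof. by rewrite ffunE (unsplitK (inl i)). Qed.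

Lemma extend_gh_rshift a (l : 'I_nb) : extend_gh a (rshift (nt M) l) = 0%N :> nat.
Proof. by rewrite ffunE (unsplitK (inr l)). Qed.

Lemma extend_gh_inj : injective extend_gh.
Proof.
move=> a a' aa'; apply/ffunP => i; apply: val_inj => /=.
by rewrite -!extend_gh_lshift aa'.
Qed.

(** Stated for any commutative law because it serves both the normalising constant in [R] and the
    mixture of expectations in [\bar R]. *)
Lemma sum_gh_pred (V : Type) (idx : V) (op : Monoid.com_law idx)
    (Phi' : ('I_(nt M') -> nat) -> V) (Phi : ('I_(nt M) -> nat) -> V) :
  (forall a, gh_valid M' Meas a -> Phi' a = Phi (fun i => a (lshift nb i))) ->
  \big[op/idx]_(a : {ffun 'I_(nt M') -> 'I_(hmax M')} | gh_valid M' Meas (fun i => a i))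
    Phi' (fun i => a i) =
  \big[op/idx]_(a : {ffun 'I_(nt M) -> 'I_(hmax M)} | gh_valid M Meas (fun i => a i))
    Phi (fun i => a i).
Proof.
move=> PhiE.
(* [extend_gh] reaches every valid hypothesis but not every function, hence a partial inverse. *)
rewrite (reindex_omap extend_gh (fun a' => [pick a | extend_gh a == a'])) => [|a' va'].
  have restr (a : {ffun 'I_(nt M) -> 'I_(hmax M)}) :
      (fun i => nat_of_ord (extend_gh a (lshift nb i))) = (fun i => nat_of_ord (a i)).
    by apply/funext => i; exact: extend_gh_lshift.
  apply: eq_big => [a|a /andP[va _]]; last by rewrite PhiE // restr.
  rewrite gh_valid_pred restr; case: pickP => [b /eqP/extend_gh_inj ->|/(_ a)]; last by rewrite eqxx.
  rewrite eqxx andbT (_ : [forall l, _]) ?andbT //.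
  by apply/forallP => l; rewrite extend_gh_rshift.
case: pickP => [a /eqP <- //|none].
move: va'; rewrite gh_valid_pred => /andP[/andP[/andP[/forallP h1 _] _] /forallP h4].
have alt i : (a' (lshift nb i) < hmax M)%N by exact: leq_trans (h1 i) (nh_le_hmax i).
have /eqP[] := none [ffun i => Ordinal (alt i)].
apply/ffunP => i; apply: val_inj; case: (split_ordP i) => j -> /=.
  by rewrite extend_gh_lshift ffunE.
by rewrite extend_gh_rshift (eqP (h4 j)).
Qed.

Lemma enum_ord_split N N' :
  enum 'I_(N + N') = [seq lshift N' i | i <- enum 'I_N] ++ [seq rshift N i | i <- enum 'I_N'].
Proof.
apply: (inj_map (@ord_inj (N + N'))); rewrite map_cat.
have -> : map (@nat_of_ord _) (map (lshift N') (enum 'I_N)) = iota 0 N.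
  by rewrite -map_comp; exact: val_enum_ord.
have -> : map (@nat_of_ord _) (map (@rshift N N') (enum 'I_N')) = iota N N'.
  rewrite -[X in iota X]addn0 iotaDl -(val_enum_ord N') -!map_comp.
  exact: eq_map.
by rewrite val_enum_ord iotaD.
Qed.

End GlobalHypotheses.

Theorem theorem1 (R : realType) (n k : nat) (hk : (1 <= k)%N)
  (PS : n.-tuple R -> R) (pix : n.-tuple R -> n.-tuple R -> R)
  (M : @mbm R n) (Meas : seq (nat * nat))
  (nb : nat) (rb : nat -> R) (fb : nat -> n.-tuple R -> R)
  (fp : nat -> nat -> @traj R n -> R) :
  (* single-target survival probability and Markov transition density pi^x(y|x) *)
  measurable_fun setT (fun x => (PS x)%:E) ->
  (forall x, 0 <= PS x <= 1) ->
  measurable_fun setT (fun yx : (n.-tuple R * n.-tuple R)%type => (pix yx.1 yx.2)%:E) ->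
  (forall y x, 0 <= pix y x) ->
  (forall x, iint n (fun y => (pix y x)%:E) = 1%E) ->
  (* trajectory multi-Bernoulli birth *)
  (forall l, (l < nb)%N ->
     [/\ 0 <= rb l <= 1, measurable_fun setT (fun x => (fb l x)%:E),
         (forall x, 0 <= fb l x) & iint n (fun x => (fb l x)%:E) = 1%E]) ->
  (* the density at time k-1 is the trajectory MBM (M, Meas) on T_{k-1} *)
  mbm_wf M k.-1 ->
  (* fp i a is the predicted single trajectory density of the theorem *)
  (forall i a, (i < nt M)%N -> (a < nh M i)%N ->
     [/\ (forall X, 0 <= fp i a X), traj_meas (fun X => (fp i a X)%:E)
       & is_pred_density k PS pix (den M i a) (fp i a)]) ->
  let M' := pred_mbm k PS M nb rb fb fp in
  [/\ nt M' = (nt M + nb)%N,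
      (forall a' : 'I_(nt M') -> nat,
         gh_valid M' Meas a' =
         gh_valid M Meas (fun i => a' (lshift nb i)) &&
         [forall l : 'I_nb, a' (rshift (nt M) l) == 0%N])
    & (forall g : seq (@traj R n) -> \bar R,
         set_meas g -> set_sym g -> (forall X, (0 <= g X)%E) ->
         setint k (fun X => (g X * (mbm_dens M' Meas X)%:E)%E) =
         pred_expect k PS pix nb rb fb (mbm_dens M Meas) g)].
Proof.
move=> mPS PS01 mpix pix0 _ birthP wfM fpP M'.
split; first by [].
  exact: gh_valid_pred.
move=> g /set_meas_meas_set_fun mg gsym g0.
have sg : swap_sym g.
  move=> P X Y S _; apply: gsym; rewrite perm_cat2l.
  by rewrite (perm_catCA [:: X] [:: Y] S).
pose bs := [seq (rb (nat_of_ord l), fB k (fb l)) | l <- enum 'I_nb].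
have okbs : all_ok bs.
  apply: all_ok_map => l; have [rb01 mfb fb0 _] := birthP l (ltn_ord l).
  exact: bcomp_ok_fB.
pose cs (a : 'I_(nt M) -> nat) :=
  [seq PredComp (ex M i (a i)) (den M i (a i)) (fp i (a i)) | i : 'I_(nt M) <- enum 'I_(nt M)].
have wfP a : gh_valid M Meas a -> forall i : 'I_(nt M), (a i < nh M i)%N.
  by move=> /andP[/andP[/forallP h1 _] _].
have okcs a : gh_valid M Meas a -> all_pred_ok k PS pix (cs a).
  move=> va; apply: (all_pred_ok_map (k := k) (PS := PS) (pix := pix)) => i.
  have [_ ex01 [f0 mf] f1 _] := wfM i (a i) (ltn_ord i) (wfP _ va i).
  have [fp0 mfp fpden] := fpP i (a i) (ltn_ord i) (wfP _ va i).
  by split=> //; split=> // b e _; exact: mf.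
have w0 a : gh_valid M Meas a -> 0 <= gh_weight M a.
  move=> va; apply: prodr_ge0 => i _.
  by have [[_ wt0] _ _ _ _] := wfM i (a i) (ltn_ord i) (wfP _ va i).
pose Z := \sum_(a : {ffun 'I_(nt M) -> 'I_(hmax M)} | gh_valid M Meas (fun i => a i))
  gh_weight M (fun i => a i).
have Z0 : 0 <= Z by apply: sumr_ge0 => a; exact: w0.
(* [Z] may be 0; division then returns 0, and the bound still holds. *)
have wZ0 a : gh_valid M Meas a -> 0 <= gh_weight M a / Z.
  by move=> va; rewrite divr_ge0 ?w0.
(* New tracks have weight 1 and one hypothesis each, so prediction leaves the normalising constant
   unchanged. *)
have ZE : \sum_(a : {ffun 'I_(nt M') -> 'I_(hmax M')} | gh_valid M' Meas (fun i => a i))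
    gh_weight M' (fun i => a i) = Z.
  rewrite /Z; apply: (@sum_gh_pred _ _ k PS M Meas nb rb fb fp _ 0 +%R
    (fun a => gh_weight M' a) (fun a => gh_weight M a)) => a _.
  exact: gh_weight_pred.
pose lr (a' : 'I_(nt M') -> nat) : 'I_(nt M) -> nat := fun i => a' (lshift nb i).
have valid_lr a' : gh_valid M' Meas a' -> gh_valid M Meas (lr a').
  by rewrite gh_valid_pred => /andP[].
have new_ok a' : gh_valid M' Meas a' ->
    all_ok (map (new_comp k PS) (cs (lr a')) ++ bs).
  by move=> va; apply: all_ok_cat => //; apply: (@all_ok_new _ _ k PS pix) => //; exact/okcs/valid_lr.
have newE (a' : 'I_(nt M') -> nat) S :
    (mb_dens (fun i : 'I_(nt M') => ex M' i (a' i)) (fun i => den M' i (a' i)) S)%:E =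
    mbl (map (new_comp k PS) (cs (lr a')) ++ bs) S.
  rewrite mb_dens_mbl /= enum_ord_split map_cat; congr (mbl (_ ++ _) S).
    by rewrite -[LHS]map_comp -[RHS]map_comp; apply: eq_map => i /=; rewrite ltn_ord.
  by rewrite -[LHS]map_comp; apply: eq_map => l /=; rewrite ltn_addF addKn.
have tr0 L : (0 <= trans_int k PS pix (mbexp k bs) L g)%E by exact: trans_int_ge0.
rewrite /mbm_dens ZE.
rewrite (@setint_mixture _ _ k _ _ (fun a : {ffun 'I_(nt M') -> 'I_(hmax M')} =>
    gh_weight M' (fun i => a i) / Z) _
  (fun a => map (new_comp k PS) (cs (lr (fun i => a i))) ++ bs)) //; first last.
- by move=> a va; exact: new_ok.
- by move=> a va; rewrite gh_weight_pred; apply: wZ0; exact: (valid_lr (fun i => a i)).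
rewrite (@sum_gh_pred _ _ k PS M Meas nb rb fb fp _ 0%E +%E
  (fun a' => ((gh_weight M' a' / Z)%:E * mbexp k (map (new_comp k PS) (cs (lr a')) ++ bs) g)%E)
  (fun a => ((gh_weight M a / Z)%:E * mbexp k (map (new_comp k PS) (cs a) ++ bs) g)%E));
  last by move=> a' _; rewrite gh_weight_pred.
(* The birth integral is replaced by its iterated form, making the integrand a symmetric function
   times the old mixture, as [setint_mixture] expects. *)
transitivity (setint k.-1 (fun X => trans_int k PS pix (mbexp k bs) X g *
  (mbm_dens M Meas X)%:E)%E); last first.
  apply: eq_setint => X vX; rewrite muleC; congr (_ * _)%E.
  apply: eq_trans_int_good => // g' mg' sg' g'0; exact/esym/birth_intE.
rewrite /mbm_dens -/Z (@setint_mixture _ _ k.-1 _ _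
  (fun a : {ffun 'I_(nt M) -> 'I_(hmax M)} => gh_weight M (fun i => a i) / Z) _
  (fun a => map (@old_comp R n) (cs (fun i => a i)))) //.
- apply: eq_bigr => a va; rewrite (@mbexp_trans_int _ _ k PS pix bs) //.
  exact: okcs.
- by move=> a va; exact: wZ0.
- by move=> a va; apply: (@all_ok_old _ _ k PS pix); exact: okcs.
- move=> a S va; rewrite mb_dens_mbl; congr mbl; rewrite -[RHS]map_comp; exact: eq_map.
- exact: pmeas_trans_int.
- exact: swap_sym_trans_int.
Qed.
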